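(* Let $n\ge2$ and let $\mathfrak{g}$ be a $2n$-dimensional strongly unimodular almost nilpotent real Lie algebra with nilradical $\mathfrak{n}$ satisfying $\dim\mathfrak{n}^1=1$, where $\mathfrak{n}^1=[\mathfrak{n},\mathfrak{n}]$. Then $\mathfrak{g}$ admits SKT structures $(J,g)$ satisfying $J\mathfrak{n}^1\subset\mathfrak{n}$ and such that $\mathfrak{k}_3$ is an abelian ideal if and only if it admits a basis $\{f_1,\dots,f_{2n}\}$ satisfying $$df^1=f^2\wedge f^3,\quad df^2=-f^2\wedge f^{2n},\quad df^3=f^3\wedge f^{2n},\quad df^{2n}=0,$$ $$df^{2l+2}=b_lf^{2l+3}\wedge f^{2n},\quad df^{2l+3}=-b_lf^{2l+2}\wedge f^{2n},\quad 1\le l\le n-2,$$ for some $b_l\in\mathbb{R}$, $1\le l\le n-2$. In particular, $\mathfrak{g}$ is $3$-step solvable and it is decomposable if and only if $b_l=0$ for some $l$, $1\le l\le n-2$. Moreover, $\mathfrak{g}$ does not admit Kähler structures. Explicit examples of SKT structures are provided by $$Jf_1=-f_2,\quad Jf_3=f_{2n},\quad Jf_{2l+2}=f_{2l+3},\ 1\le l\le n-2,\qquad g=\sum_{l=1}^{2n}(f^l)^2.$$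
   Context: The nilradical $\mathfrak{n}$ of a solvable Lie algebra $\mathfrak{g}$ is its maximal nilpotent ideal; $\mathfrak{g}$ is almost nilpotent if it is solvable and $\mathfrak{n}$ has codimension one. With $\mathfrak{n}^0=\mathfrak{n}$, $\mathfrak{n}^{l}=[\mathfrak{n},\mathfrak{n}^{l-1}]$, a solvable $\mathfrak{g}$ is strongly unimodular if $\operatorname{tr}(\mathrm{ad}_X|_{\mathfrak{n}^l/\mathfrak{n}^{l+1}})=0$ for all $X\in\mathfrak{g}$, $l\in\mathbb{N}$. A Hermitian structure $(J,g)$ on $\mathfrak{g}$ is an integrable complex structure $J$ (vanishing Nijenhuis tensor) together with a positive definite $J$-orthogonal inner product $g$; $\omega=g(J\cdot,\cdot)$. It is SKT if $dd^c\omega=0$ and Kähler if $d\omega=0$, with $d$ the Chevalley–Eilenberg differential ($d\alpha(X,Y)=-\alpha([X,Y])$) and $d^c=i(\overline\partial-\partial)$. For $(J,g)$ with $J\mathfrak{n}^1\subset\mathfrak{n}$, set $\mathfrak{k}_2=(\mathfrak{n}^1)^{\perp_g}\cap\mathfrak{n}$ and $\mathfrak{k}_3=\mathfrak{k}_2\cap J\mathfrak{k}_2$ (a $(2n-4)$-dimensional subspace, zero when $n=2$). Decomposable means isomorphic to a direct sum of two nonzero Lie algebras. *)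

(* Defs.v *)
From HB Require Import structures.
From mathcomp Require Import all_boot all_order all_algebra.
From mathcomp Require Import complex reals.

Set Implicit Arguments.
Unset Strict Implicit.
Unset Printing Implicit Defensive.

Import Order.TTheory GRing.Theory Num.Theory.
Local Open Scope ring_scope.

HB.mixin Record Vector_isLieAlg (K : fieldType) V of Vector K V := {
  lieb : V -> V -> V;
  lieb_linearl : forall y : V, linear (lieb ^~ y);
  lieb_linearr : forall x : V, linear (lieb x);
  liebxx : forall x : V, lieb x x = 0;
  lieb_jacobi : forall x y z : V,
    lieb x (lieb y z) + lieb y (lieb z x) + lieb z (lieb x y) = 0
}.

#[short(type="lieAlgType")]
HB.structure Definition LieAlg (K : fieldType) :=
  { V of Vector K V & Vector_isLieAlg K V }.

Section DirectSum.
Context (K : fieldType) (V W : lieAlgType K).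

Definition prod_lieb (x y : V * W) : V * W := (lieb x.1 y.1, lieb x.2 y.2).

Fact prod_lieb_linearl (y : V * W) : linear (prod_lieb ^~ y).
Proof. by move=> a u v; rewrite /prod_lieb /= !lieb_linearl. Qed.

Fact prod_lieb_linearr (x : V * W) : linear (prod_lieb x).
Proof. by move=> a u v; rewrite /prod_lieb /= !lieb_linearr. Qed.

Fact prod_liebxx (x : V * W) : prod_lieb x x = 0.
Proof. by rewrite /prod_lieb !liebxx. Qed.

Fact prod_lieb_jacobi (x y z : V * W) :
  prod_lieb x (prod_lieb y z) + prod_lieb y (prod_lieb z x)
  + prod_lieb z (prod_lieb x y) = 0.
Proof. by congr pair => /=; apply: lieb_jacobi. Qed.

HB.instance Definition _ := Vector_isLieAlg.Build K (V * W)%type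
  prod_lieb_linearl prod_lieb_linearr prod_liebxx prod_lieb_jacobi.
End DirectSum.

Definition decomposable (K : fieldType) (g : lieAlgType K) : Prop :=
  exists g1 g2 : lieAlgType K,
    [/\ (0 < \dim {:g1})%N, (0 < \dim {:g2})%N
      & exists2 phi : 'Hom(g, (g1 * g2)%type),
          bijective phi & {morph phi : x y / lieb x y >-> lieb x y}].

Section LieTheory.
Context (K : fieldType) (g : lieAlgType K).
Implicit Types (U W X I N : {vspace g}).

(* [U, W], the span of all brackets; see lieS_subP. *)
Definition lieS U W : {vspace g} :=
  <<[seq lieb u w | u <- vbasis U, w <- vbasis W]>>%VS.

Lemma lieS_subP U W X :
  reflect {in U & W, forall u w, lieb u w \in X} (lieS U W <= X)%VS.
Proof.
apply: (iffP span_subvP) => [sX u w uU wW|sX _ /allpairsP[[u w] /= [uU wW ->]]];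
  last by apply: sX; apply: vbasis_mem.
have lr x := @lieb_linearr _ g x; have ll y := @lieb_linearl _ g y.
pose fr x : {linear g -> g} := HB.pack (lieb x) (GRing.isLinear.Build _ _ _ _ _ (lr x)).
pose fl y : {linear g -> g} := HB.pack (lieb^~ y) (GRing.isLinear.Build _ _ _ _ _ (ll y)).
rewrite (coord_vbasis wW); rewrite -[lieb u _]/(fr u _) linear_sum.
apply: memv_suml => j _; rewrite linearZ /=; apply: memvZ.
rewrite (coord_vbasis uU); rewrite -[lieb _ _]/(fl _ _) linear_sum.
apply: memv_suml => i _; rewrite linearZ /=; apply: memvZ.
by apply/sX/allpairsP; exists ((vbasis U)`_i, (vbasis W)`_j); split;
  rewrite ?mem_nth ?size_tuple.
Qed.

Definition is_ideal I : Prop := (lieS fullv I <= I)%VS.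
Definition is_abelian I : Prop := lieS I I = 0%VS.

(* lcs N l is N^l, with N^0 = N and N^l = [N, N^(l-1)]. *)
Fixpoint lcs N (l : nat) : {vspace g} :=
  if l is l'.+1 then lieS N (lcs N l') else N.

Definition derived_series (l : nat) : {vspace g} :=
  iter l (fun W => lieS W W) fullv.

Definition is_nilpotent N : Prop := exists l, lcs N l = 0%VS.
Definition solvable_lie : Prop := exists l, derived_series l = 0%VS.
Definition step_solvable (k : nat) : Prop :=
  derived_series k = 0%VS /\ forall j, (j < k)%N -> derived_series j <> 0%VS.

(* Sums of nilpotent ideals being nilpotent ideals, there is exactly one
   such N. *)
Definition is_nilradical N : Prop :=
  [/\ is_ideal N, is_nilpotent N
    & forall I, is_ideal I -> is_nilpotent I -> (N <= I)%VS -> I = N].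

Definition almost_nilpotent N : Prop :=
  [/\ solvable_lie, is_nilradical N & (\dim N).+1 = \dim {:g}].

(* Trace of the endomorphism of U / W induced by f, for W <= U both stable
   under f: the complement U :\: W of W in U is a model of U / W, the
   canonical surjection being the projection of U onto it along W. *)
Definition quo_trace (f : g -> g) U W : K :=
  let X := vbasis (U :\: W)%VS in
  \sum_(i < \dim (U :\: W)%VS) coord X i (addv_pi1 U W (f X`_i)).

Definition strongly_unimodular N : Prop :=
  solvable_lie /\
  forall (x : g) (l : nat), quo_trace (lieb x) (lcs N l) (lcs N l.+1) = 0.

End LieTheory.

Section Cochains.
Context (K : fieldType) (g : lieAlgType K) (A : nzRingType).

Definition cochain (k : nat) := {ffun 'I_k -> g} -> A.

(* Chevalley-Eilenberg differential:
     (d alpha)(X_0, ..., X_(k+1)) = \sum_(i < j) (-1)^(i+j)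
       alpha([X_i, X_j], X_0, .., X_i omitted, .., X_j omitted, .., X_(k+1)).
   For i < j, lift j i has value i, and m |-> lift j (lift i m) enumerates
   the indices other than i and j. On 1-cochains this is
   (d alpha)(X, Y) = - alpha([X, Y]). *)
Definition ced (k : nat) (alpha : cochain k.+1) : cochain k.+2 := fun X =>
  \sum_(j < k.+2) \sum_(i < k.+1 | (i < j)%N)
    (-1) ^+ (i + j) *
    alpha [ffun m : 'I_k.+1 =>
             if unlift ord0 m is Some m' then X (lift j (lift i m'))
             else lieb (X (lift j i)) (X j)].

Definition form1 (a : g -> A) : cochain 1 := fun X => a (X ord0).

Definition wedge (a b : g -> A) : cochain 2 := fun X =>
  a (X ord0) * b (X ord_max) - a (X ord_max) * b (X ord0).

End Cochains.

Section Hermitian.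
Context (R : realType) (g : lieAlgType R).
Implicit Types (J : 'End(g)) (met : {dot g for idfun}).

Definition nijenhuis J (x y : g) : g :=
  lieb (J x) (J y) - J (lieb (J x) y) - J (lieb x (J y)) - lieb x y.

Definition hermitian_structure J met : Prop :=
  [/\ forall x, J (J x) = - x,
      forall x y, nijenhuis J x y = 0
    & forall x y, met (J x) (J y) = met x y].

Definition fund_form J met : cochain g R 2 :=
  fun X => met (J (X ord0)) (X ord_max).

Definition kaehler J met : Prop :=
  forall X, ced (fund_form J met) X = 0.

(* The component of bidegree (p, k - p) of a complex-valued k-form: sum over
   the sets S of p slots of the complex-multilinear extension of alpha applied
   to (X_j - i J X_j) / 2, the (1,0)-part of X_j, in the slots of S and to
   (X_j + i J X_j) / 2, its (0,1)-part, in the other ones. T is the set of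
   slots where the term in J X_j is picked in the expansion. *)
Definition bidegree J (k p : nat) (alpha : cochain g R[i] k) :
    cochain g R[i] k := fun X =>
  \sum_(S : {set 'I_k} | #|S| == p) \sum_(T : {set 'I_k})
    (\prod_(j in T) (if j \in S then - 'i%C else 'i%C)) / 2 ^+ k *
    alpha [ffun j => if j \in T then J (X j) else X j].

Definition del J (k : nat) (alpha : cochain g R[i] k.+1) :
    cochain g R[i] k.+2 := fun X =>
  \sum_(p < k.+2) bidegree J p.+1 (ced (bidegree J p alpha)) X.

Definition delbar J (k : nat) (alpha : cochain g R[i] k.+1) :
    cochain g R[i] k.+2 := fun X =>
  \sum_(p < k.+2) bidegree J p (ced (bidegree J p alpha)) X.

Definition dc J (k : nat) (alpha : cochain g R[i] k.+1) :
    cochain g R[i] k.+2 := fun X =>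
  'i%C * (delbar J alpha X - del J alpha X).

Definition skt J met : Prop :=
  forall X, ced (dc J (fun Y => (fund_form J met Y)%:C%C)) X = 0.

Definition k2 met (N : {vspace g}) : {vspace g} :=
  (orthov met (lcs N 1) :&: N)%VS.

Definition k3 J met (N : {vspace g}) : {vspace g} :=
  (k2 met N :&: J @: k2 met N)%VS.

Definition special_skt J met (N : {vspace g}) : Prop :=
  [/\ hermitian_structure J met, skt J met, (J @: lcs N 1 <= N)%VS,
      is_ideal (k3 J met N) & is_abelian (k3 J met N)].

(* vec f k and cov f k are f_k and f^k, for 1 <= k <= m. *)
Definition vec (m : nat) (f : m.-tuple g) (k : nat) : g := f`_k.-1.

Definition cov (m : nat) (f : m.-tuple g) (k : nat) (x : g) : R :=
  \sum_(i < m | i.+1 == k) coord f i x.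

Definition adapted_basis (n : nat) (f : (2 * n).-tuple g) (b : nat -> R) :
    Prop :=
  let d k := ced (form1 (cov f k)) in
  let w j k := wedge (cov f j) (cov f k) in
  [/\ basis_of fullv f,
      [/\ forall X, d 1%N X = w 2%N 3%N X,
          forall X, d 2%N X = - w 2%N (2 * n)%N X,
          forall X, d 3%N X = w 3%N (2 * n)%N X
        & forall X, d (2 * n)%N X = 0]
    & forall l, (1 <= l <= n - 2)%N ->
        (forall X, d (2 * l + 2)%N X
                   = b l * w (2 * l + 3)%N (2 * n)%N X) /\
        (forall X, d (2 * l + 3)%N X
                   = - b l * w (2 * l + 2)%N (2 * n)%N X)].

(* These values and J^2 = - id determine J. *)
Definition standard_J (n : nat) (f : (2 * n).-tuple g) J : Prop :=
  [/\ J (vec f 1) = - vec f 2, J (vec f 3) = vec f (2 * n)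
    & forall l, (1 <= l <= n - 2)%N ->
        J (vec f (2 * l + 2)) = vec f (2 * l + 3)].

Definition standard_metric (n : nat) (f : (2 * n).-tuple g) met : Prop :=
  forall x y, met x y = \sum_(1 <= l < (2 * n).+1) cov f l x * cov f l y.

End Hermitian.

(* Main.v *)
(* Forward direction. Let e1 be a unit vector spanning n^1, e2 = J e1, let et be a
   unit normal to n and e3 = - J et. Strong unimodularity makes e1 central and, k3
   being an abelian ideal, [e2, e3] = c e1 is the only nonzero bracket of n.
   Integrability gives [et, e2] = - c e2 and shows that A = ad(et) commutes with J
   on k3. At (x, J x, e3, et), with x in k3, the SKT equation reads
     |A x|^2 + <A (A x), x> + c <A x, x> = 0.
   Unimodularity gives tr A = 0 on k3, so the sum over an orthonormal basis of k3
   says that |A + A^T|^2 = 0: A is skew and commutes with J, hence has a normal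
   form made of plane rotation generators.

   Backward direction. For the standard structure d omega = - f^1 f^2 f^{2n}, so
   that d^c omega is up to sign the closed form f^1 f^2 f^3.

   No Kaehler structure. Since z = f_1 is central, T = ad(J z) commutes with J and
   J z is orthogonal to [g, g]. If f^{2n}(J z) <> 0 then T has a nonzero real
   eigenvalue of multiplicity one, which is impossible for a map commuting with J.
   Otherwise T = 0, and closedness of omega makes z orthogonal to [g, g], which
   contains z.

   Decomposability. If no b_l vanishes then [g, g] has codimension one, whereas a
   direct sum of two nonzero solvable algebras has a derived algebra of
   codimension at least two. If b_l = 0 then f_{2l+2} spans a direct factor. *)
From HB Require Import structures.
Require Import Defs.
From mathcomp Require Import all_boot all_order all_algebra.
From mathcomp Require Import complex reals.
From mathcomp Require Import ring lra zify.

Set Implicit Arguments.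
Unset Strict Implicit.
Unset Printing Implicit Defensive.

Import Order.TTheory GRing.Theory Num.Theory.
Local Open Scope ring_scope.

(** * Brackets and Chevalley-Eilenberg differentials *)

Lemma linear_lfun (K : fieldType) (V W : vectType K) (f : V -> W) :
  linear f -> exists F : 'Hom(V, W), F =1 f.
Proof.
move=> f_lin; pose F := HB.pack_for {linear V -> W} f
  (GRing.isLinear.Build K V W *:%R f f_lin).
by exists (linfun F) => x; rewrite lfunE.
Qed.

Section LieBasics.
Variables (K : fieldType) (g : lieAlgType K).
Implicit Types (x y z : g) (U W I : {vspace g}).

Definition ad x : 'End(g) :=
  linfun (HB.pack_for {linear g -> g} (lieb x)
    (GRing.isLinear.Build K g g _ (lieb x) (lieb_linearr x))).

Lemma adE x y : ad x y = lieb x y. Proof. exact: lfunE. Qed.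

Lemma liebDr x y z : lieb x (y + z) = lieb x y + lieb x z.
Proof. by rewrite -!adE linearD. Qed.
Lemma liebZr a x y : lieb x (a *: y) = a *: lieb x y.
Proof. by rewrite -!adE linearZ. Qed.
Lemma liebNr x y : lieb x (- y) = - lieb x y.
Proof. by rewrite -!adE linearN. Qed.
Lemma lieb0r x : lieb x 0 = 0. Proof. by rewrite -adE linear0. Qed.
Lemma lieb_sumr (T : Type) (r : seq T) (P : pred T) F x :
  lieb x (\sum_(i <- r | P i) F i) = \sum_(i <- r | P i) lieb x (F i).
Proof.
rewrite -[LHS]adE linear_sum; by apply: eq_bigr => i _; exact: adE.
Qed.

Lemma liebDl x y z : lieb (y + z) x = lieb y x + lieb z x.
Proof. by have := lieb_linearl x 1 y z; rewrite !scale1r. Qed.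
Lemma lieb0l x : lieb 0 x = 0.
Proof. by apply: (addrI (lieb 0 x)); rewrite -liebDl !addr0. Qed.
Lemma liebZl a x y : lieb (a *: y) x = a *: lieb y x.
Proof. by have := lieb_linearl x a y 0; rewrite lieb0l !addr0. Qed.
Lemma liebNl x y : lieb (- y) x = - lieb y x.
Proof. by rewrite -scaleN1r liebZl scaleN1r. Qed.
Lemma liebC x y : lieb x y = - lieb y x.
Proof.
apply/eqP; rewrite -addr_eq0; have := liebxx (x + y).
by rewrite liebDl !liebDr !liebxx add0r addr0 => ->.
Qed.

Lemma lieb_derivation x y z :
  lieb x (lieb y z) = lieb (lieb x y) z + lieb y (lieb x z).
Proof.
have /eqP := lieb_jacobi x y z.
rewrite -addrA addr_eq0 => /eqP ->.
by rewrite opprD addrC [lieb (lieb x y) z]liebC (liebC z x) liebNr opprK.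
Qed.

Definition liebE := (liebDl, liebDr, liebZl, liebZr, liebNl, liebNr, lieb0l,
  lieb0r).

Lemma lieb_lieS U W u w : u \in U -> w \in W -> lieb u w \in lieS U W.
Proof. by move=> uU wW; have /lieS_subP := subvv (lieS U W); apply. Qed.

Lemma is_idealP I : is_ideal I <-> forall x y, y \in I -> lieb x y \in I.
Proof.
split=> [/lieS_subP h x y yI | h]; first by apply: h; rewrite ?memvf.
by apply/lieS_subP => u w _; apply: h.
Qed.

Lemma is_abelianP I : is_abelian I <-> {in I &, forall x y, lieb x y = 0}.
Proof.
split=> [h x y xI yI | h].
  by apply/eqP; rewrite -memv0 -h lieb_lieS.
by apply/eqP; rewrite -subv0; apply/lieS_subP => u w uI wI; rewrite h ?mem0v.
Qed.

End LieBasics.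

Section CochainFormulas.
Variables (K : fieldType) (g : lieAlgType K) (A : nzRingType).

(** Indices are iterated [lift]s rather than numerals, so that they agree syntactically with what
    [big_ord_recl] produces. *)
Definition i0 n : 'I_n.+1 := ord0.
Definition i1 n : 'I_n.+2 := lift ord0 ord0.
Definition i2 n : 'I_n.+3 := lift ord0 (lift ord0 ord0).
Definition i3 n : 'I_n.+4 := lift ord0 (lift ord0 (lift ord0 ord0)).

Lemma eq_ced k (a b : cochain g A k.+1) : a =1 b -> ced a =1 ced b.
Proof.
by move=> ab X; do 2![apply: eq_bigr => ? _]; rewrite ab.
Qed.

Lemma ced0 k (a : cochain g A k.+1) : (forall X, a X = 0) ->
  forall X, ced a X = 0.
Proof.
by move=> a0 X; do 2![rewrite /ced big1 // => ? _]; rewrite a0 mulr0.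
Qed.

Lemma ced_form1 (a : g -> A) X :
  ced (form1 a) X = - a (lieb (X (i0 _)) (X (i1 _))).
Proof.
rewrite /ced !big_ord_recl !big_ord0 big_pred0 ?add0r => [|[]] //.
rewrite (bigD1 ord0) //= big_pred0 => [|i]; last by rewrite (ord1 i).
rewrite !addr0 expr1 mulN1r /form1 ffunE unlift_none.
by congr (- a (lieb (X _) (X _))); apply: val_inj.
Qed.

Let sgn1 : (-1) ^+ 1 = -1 :> A. Proof. exact: expr1. Qed.
Let sgn2 : (-1) ^+ 2 = 1 :> A. Proof. by rewrite exprS sgn1 mulrNN mulr1. Qed.
Let sgn3 : (-1) ^+ 3 = -1 :> A. Proof. by rewrite exprS sgn2 mulr1. Qed.
Let sgn4 : (-1) ^+ 4 = 1 :> A. Proof. by rewrite exprS sgn3 mulrNN mulr1. Qed.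
Let sgn5 : (-1) ^+ 5 = -1 :> A. Proof. by rewrite exprS sgn4 mulr1. Qed.
Let sgnE := (sgn1, sgn2, sgn3, sgn4, sgn5).

Let ffun_ced := (ffunE, unlift_none, liftK).

(** Presenting the cochain by a function [F] of separate vectors keeps finite functions out of all
    later computations. *)
Lemma ced_form2 (a : cochain g A 2) F :
    (forall Y, a Y = F (Y (i0 _)) (Y (i1 _))) -> forall X,
  ced a X = - F (lieb (X (i0 _)) (X (i1 _))) (X (i2 _))
            + F (lieb (X (i0 _)) (X (i2 _))) (X (i1 _))
            - F (lieb (X (i1 _)) (X (i2 _))) (X (i0 _)).
Proof.
move=> aE X; rewrite /ced.
under eq_bigr do rewrite big_mkcond /= !big_ord_recl big_ord0 /=.
rewrite !big_ord_recl big_ord0 /= !addr0 !add0r !aE !ffun_ced /=.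
rewrite !sgnE !mul1r !mulN1r !addrA.
by do !congr (_ + _); do ?congr (- _); congr (F (lieb (X _) (X _)) (X _));
  apply: val_inj.
Qed.

Lemma ced_form3 (a : cochain g A 3) F :
    (forall Y, a Y = F (Y (i0 _)) (Y (i1 _)) (Y (i2 _))) -> forall X,
  ced a X = - F (lieb (X (i0 _)) (X (i1 _))) (X (i2 _)) (X (i3 _))
            + F (lieb (X (i0 _)) (X (i2 _))) (X (i1 _)) (X (i3 _))
            - F (lieb (X (i1 _)) (X (i2 _))) (X (i0 _)) (X (i3 _))
            - F (lieb (X (i0 _)) (X (i3 _))) (X (i1 _)) (X (i2 _))
            + F (lieb (X (i1 _)) (X (i3 _))) (X (i0 _)) (X (i2 _))
            - F (lieb (X (i2 _)) (X (i3 _))) (X (i0 _)) (X (i1 _)).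
Proof.
move=> aE X; rewrite /ced.
under eq_bigr do rewrite big_mkcond /= !big_ord_recl big_ord0 /=.
rewrite !big_ord_recl big_ord0 /= !addr0 !add0r !aE !ffun_ced /=.
rewrite !sgnE !mul1r !mulN1r !addrA.
by do !congr (_ + _); do ?congr (- _);
  congr (F (lieb (X _) (X _)) (X _) (X _)); apply: val_inj.
Qed.

End CochainFormulas.

(** * Bidegrees *)

Section SubsetSums.
Variable V : nmodType.

(** Bit tuples replace subsets because a sum over tuples splits on the first bit, so that the sums
    in [bidegree] unfold by rewriting. *)
Definition bits_set n (b : n.-tuple bool) : {set 'I_n} := [set i | tnth b i].

Lemma bits_set_bij n : bijective (@bits_set n).
Proof.
exists (fun S : {set 'I_n} => [tuple i \in S | i < n]) => [b|S].
  by apply: eq_from_tnth => i; rewrite tnth_mktuple inE.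
by apply/setP => i; rewrite inE tnth_mktuple.
Qed.

Lemma big_tuple_cons n (F : n.+1.-tuple bool -> V) :
  \sum_b F b = \sum_(b : n.-tuple bool) F [tuple of true :: b]
             + \sum_(b : n.-tuple bool) F [tuple of false :: b].
Proof.
pose h (p : bool * n.-tuple bool) := [tuple of p.1 :: p.2].
have h_bij : bijective h.
  exists (fun b : n.+1.-tuple bool => (thead b, [tuple of behead b])).
    by move=> [x b]; congr pair; apply: val_inj.
  by move=> b; rewrite [RHS]tuple_eta.
rewrite (reindex h) /=; last exact: onW_bij.
rewrite -(pair_bigA _ (fun x b => F (h (x, b)))) /=.
by rewrite big_bool.
Qed.

Lemma big_tuple0 (F : 0.-tuple bool -> V) : \sum_b F b = F [tuple].
Proof.
rewrite (bigD1 [tuple]) //= big_pred0 ?addr0 // => b.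
by apply/negbF/eqP; exact: tuple0.
Qed.

Lemma sum_subsets n (F : {set 'I_n} -> V) :
  \sum_S F S = \sum_(b : n.-tuple bool) F (bits_set b).
Proof. by rewrite (reindex _ (onW_bij _ (bits_set_bij n))). Qed.

Lemma card_bits_set n (b : n.-tuple bool) : #|bits_set b| = count id b.
Proof.
rewrite -sum1_card -sum1_count big_tuple.
by apply: eq_bigl => i; rewrite inE.
Qed.

End SubsetSums.

Section Bidegree.
Variables (R : realType) (g : lieAlgType R) (J : 'End(g)).

Let ci : R[i] := 'i%C.

Lemma eq_bidegree k p (a b : cochain g R[i] k) : a =1 b ->
  bidegree J p a =1 bidegree J p b.
Proof. by move=> ab X; do 2![apply: eq_bigr => ? _]; rewrite ab. Qed.

Lemma bidegree0 k p (a : cochain g R[i] k) : (forall X, a X = 0) ->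
  forall X, bidegree J p a X = 0.
Proof.
by move=> a0 X; do 2![rewrite /bidegree big1 // => ? _]; rewrite a0 mulr0.
Qed.

(** [s] tells whether the slot carries the (1,0)-part, and [t] whether its term in [J] is picked. *)
Let coef (s t : bool) : R[i] := if t then (if s then - ci else ci) else 1.

Lemma bidegree_bits k p (a : cochain g R[i] k) X :
  bidegree J p a X = \sum_(s : k.-tuple bool | count id s == p)
    \sum_(t : k.-tuple bool) (\prod_(j < k) coef (tnth s j) (tnth t j)) / 2 ^+ k *
      a [ffun j => if tnth t j then J (X j) else X j].
Proof.
rewrite /bidegree big_mkcond sum_subsets [RHS]big_mkcond /=.
apply: eq_bigr => s _; rewrite card_bits_set; case: ifP => // _.
rewrite sum_subsets; apply: eq_bigr => t _; congr (_ / _ * a _); last first.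
  by apply/ffunP => j; rewrite !ffunE inE.
rewrite big_mkcond; apply: eq_bigr => j _; rewrite !inE /coef.
by case: (tnth t j); case: (tnth s j).
Qed.

Let ci2 : ci * ci = -1. Proof. by rewrite -expr2 sqr_i. Qed.

(** The hypotheses on [F] express type (1,1) at the given arguments: the (2,0) and (0,2) parts get
    the coefficient 1 + i^2 = 0, the (1,1) part the coefficient (1 - i^2)/2 = 1. *)
Lemma bidegree2 p (a : cochain g R[i] 2) F :
    (forall Y, a Y = F (Y (i0 _)) (Y (i1 _))) ->
    forall X : {ffun _ -> g},
    let x := X (i0 _) in let y := X (i1 _) in
    (F (J x) (J y) = F x y) -> F (J x) y = - F x (J y) ->
  bidegree J p a X = if p == 1%N then F x y else 0.
Proof.
move=> aE X x y Fxy FJ; rewrite bidegree_bits big_mkcond /=.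
rewrite !big_tuple_cons !big_tuple0 /= !big_tuple_cons !big_tuple0 /=.
rewrite !big_ord_recl !big_ord0 /= !aE !ffunE /=.
rewrite -[X (i0 1)]/x -[X (i1 0)]/y Fxy FJ.
have -> : (2 : R[i]) ^+ 2 = 4 by ring.
case: p => [|[|[|p]]] /=; rewrite ?add0r ?addr0 /coef /=.
- transitivity ((1 + ci * ci) / 4 * F x y); first by ring.
  by rewrite ci2 subrr !mul0r.
- transitivity ((1 - ci * ci) / 2 * F x y); first by field.
  by rewrite ci2 opprK; field.
- transitivity ((1 + ci * ci) / 4 * F x y); first by ring.
  by rewrite ci2 subrr !mul0r.
- by [].
Qed.

(** Inserting [J] in all slots multiplies a (2,1)-form by i and a (1,2)-form by -i, whence the
    formula. The hypothesis excludes the types (3,0) and (0,3), for which its two sides have the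
    factors -i and 3i, or their conjugates. *)
Lemma bidegree3_diff (a : cochain g R[i] 3) F :
    (forall Y, a Y = F (Y (i0 _)) (Y (i1 _)) (Y (i2 _))) ->
    forall X : {ffun _ -> g},
    let x := X (i0 _) in let y := X (i1 _) in let z := X (i2 _) in
    F (J x) (J y) (J z) = F (J x) y z + F x (J y) z + F x y (J z) ->
  ci * (bidegree J 1 a X - bidegree J 2 a X) = - F (J x) (J y) (J z).
Proof.
move=> aE X x y z FJ.
set u := F x y z; set u1 := F (J x) y z; set u2 := F x (J y) z.
set u3 := F x y (J z); set v1 := F (J x) (J y) z; set v2 := F (J x) y (J z).
set v3 := F x (J y) (J z).
pose c s := if s then - ci else ci.
(* [G p q r] expands [F] at (x + p J x)/2, (y + q J y)/2, (z + r J z)/2, with the value at (J x, J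
   y, J z) already replaced by means of [FJ]. *)
pose G (p q r : R[i]) := (u + p * u1 + q * u2 + r * u3 + p * q * v1
  + p * r * v2 + q * r * v3 + p * q * r * (u1 + u2 + u3)) / 8.
have E p : bidegree J p a X = \sum_(s : 3.-tuple bool | count id s == p)
    G (c (tnth s (i0 _))) (c (tnth s (i1 _))) (c (tnth s (i2 _))).
  rewrite bidegree_bits; apply: eq_bigr => s _.
  rewrite !big_tuple_cons !big_tuple0 /=.
  rewrite !big_ord_recl !big_ord0 /= !aE !ffunE /=.
  rewrite -[X (i0 _)]/x -[X (i1 _)]/y -[X (i2 _)]/z /coef /= FJ.
  rewrite -/(c _) -/(c (tnth s (i1 _))) -/(c (tnth s (i2 _))) /G.
  by rewrite -/u -/u1 -/u2 -/u3 -/v1 -/v2 -/v3; field.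
rewrite !E !(big_mkcond (fun _ => _ == _)) !big_tuple_cons !big_tuple0.
rewrite /G /i0 /i1 /i2 /c /=.
rewrite ?(add0r, addr0).
transitivity ((ci * ci - 3 * (ci * ci) * (ci * ci)) / 4 * (u1 + u2 + u3)).
  by field.
by rewrite FJ -/u1 -/u2 -/u3 ci2; field.
Qed.

End Bidegree.

(** * Inner products and the Bismut torsion form *)

Section DotBasics.
Variables (R : realType) (V : vectType R) (met : {dot V for idfun}).
Implicit Types (x y z : V) (U : {vspace V}).

Lemma dotC x y : met x y = met y x.
Proof. by rewrite hermC /= expr0 mul1r. Qed.
Lemma dotDr x y z : met x (y + z) = met x y + met x z.
Proof. exact: linearDr. Qed.
Lemma dotNr x y : met x (- y) = - met x y.
Proof. exact: linearNr. Qed.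
Lemma dotZr a x y : met x (a *: y) = a * met x y.
Proof. exact: linearZr_LR. Qed.
Lemma dot0r x : met x 0 = 0. Proof. exact: linear0r. Qed.
Lemma dotDl x y z : met (y + z) x = met y x + met z x.
Proof. exact: linearDl. Qed.
Lemma dotNl x y : met (- y) x = - met y x.
Proof. exact: linearNl. Qed.
Lemma dotZl a x y : met (a *: y) x = a * met y x.
Proof. exact: linearZl_LR. Qed.
Lemma dot0l x : met 0 x = 0. Proof. exact: linear0l. Qed.
Lemma dot_suml (I : Type) (r : seq I) (P : pred I) F x :
  met (\sum_(i <- r | P i) F i) x = \sum_(i <- r | P i) met (F i) x.
Proof. exact: linear_sumlz. Qed.
Lemma dot_sumr (I : Type) (r : seq I) (P : pred I) F x :
  met x (\sum_(i <- r | P i) F i) = \sum_(i <- r | P i) met x (F i).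
Proof. by rewrite dotC dot_suml; apply: eq_bigr => i _; rewrite dotC. Qed.

Definition dotE := (dotDl, dotDr, dotZl, dotZr, dotNl, dotNr, dot0l, dot0r).

Lemma dot_gt0 x : (0 < met x x) = (x != 0).
Proof.
have [->|/neq0_dnorm_gt0->//] := eqVneq x 0.
by rewrite dot0l ltxx.
Qed.

Lemma dot_ge0 x : 0 <= met x x.
Proof. by have [->|x0] := eqVneq x 0; rewrite ?dot0l // ltW ?dot_gt0. Qed.

Lemma dot_eq0 x : (met x x == 0) = (x == 0).
Proof.
apply/idP/eqP => [m0|->]; last by rewrite dot0l.
by apply/eqP; rewrite -[_ == _]negbK -dot_gt0 (eqP m0) ltxx.
Qed.

Lemma dot_neq0 x : x != 0 -> met x x != 0.
Proof. by rewrite dot_eq0. Qed.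

Lemma mem_orthov_line u x : (x \in orthov met <[u]>) = (met x u == 0).
Proof. exact: mem_orthov1. Qed.

Lemma dim_cap_orthov1 U x : x \in U -> x != 0 ->
  (\dim (U :&: orthov met <[x]>)).+1 = \dim U.
Proof.
move=> xU x0; rewrite -eq_dim_orthov1 ?prednK ?lt0n ?dimv_eq0 //.
  by apply: contraNneq x0 => U0; rewrite -memv0 -U0.
by apply/mem_orthovPn; exists x => //; rewrite dot_eq0.
Qed.

End DotBasics.

Section Hermitian.
Variables (R : realType) (g : lieAlgType R) (J : 'End(g)).
Variable met : {dot g for idfun}.
Hypothesis herm : hermitian_structure J met.
Implicit Types x y z : g.

Lemma JJ x : J (J x) = - x. Proof. by case: herm. Qed.

Lemma dotJJ x y : met (J x) (J y) = met x y. Proof. by case: herm. Qed.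

Lemma dotJl x y : met (J x) y = - met x (J y).
Proof. by rewrite -[LHS]dotJJ JJ dotNl. Qed.

Lemma dotJxx x : met (J x) x = 0.
Proof. by have := dotJl x x; rewrite (dotC met x); lra. Qed.

Lemma nijenhuis_eq x y :
  lieb (J x) (J y) - lieb x y = J (lieb (J x) y + lieb x (J y)).
Proof.
have [_ /(_ x y) N0 _] := herm.
apply/eqP; rewrite -subr_eq0 -[X in _ == X]N0 /nijenhuis linearD opprD /=.
by apply/eqP; rewrite -!addrA; congr (_ + _); rewrite addrC -addrA.
Qed.

Let w x y := met (J x) y.
Let dw x y z := - w (lieb x y) z + w (lieb x z) y - w (lieb y z) x.

Lemma ced_fund_form X : ced (fund_form J met) X =
  dw (X (i0 _)) (X (i1 _)) (X (i2 _)).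
Proof.
rewrite (@ced_form2 _ _ _ _ w) // => Y; congr (w (Y _) (Y _)).
exact: val_inj.
Qed.

(* d^c omega (see dc_fund_form), up to sign the torsion of the Bismut connection. *)
Definition bismut x y z := met (lieb (J x) (J y)) z
  - met (lieb (J x) (J z)) y + met (lieb (J y) (J z)) x.

(** As omega has type (1,1), d^c omega is i times the difference of the (1,2) and (2,1) parts of d
    omega; [bidegree3_diff] turns it into minus d omega with [J] in all slots. *)
Lemma dc_fund_form (X : {ffun 'I_3 -> g}) :
  dc J (fun Y => (fund_form J met Y)%:C%C) X =
  (bismut (X (i0 _)) (X (i1 _)) (X (i2 _)))%:C%C.
Proof.
set a : cochain g _ 2 := fun Y => _.
have aE Y : a Y = (w (Y (i0 _)) (Y (i1 _)))%:C%C.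
  by rewrite /a /fund_form; congr (w (Y _) (Y _))%:C%C; exact: val_inj.
have bE p Y : bidegree J p a Y = if p == 1%N then a Y else 0.
  rewrite (@bidegree2 _ _ _ _ _ (fun x y => (w x y)%:C%C) aE) ?aE //=.
    by rewrite /w !dotJJ.
  by rewrite /w dotJJ JJ dotNl raddfN.
have dE p Z : p != 1%N -> ced (bidegree J p a) Z = 0.
  by move=> /negPf p1; apply: ced0 => Y; rewrite bE p1.
have d1 : ced (bidegree J 1 a) =1 ced a by apply: eq_ced => Y; rewrite bE.
have daE Y : ced a Y = (dw (Y (i0 _)) (Y (i1 _)) (Y (i2 _)))%:C%C.
  by rewrite (@ced_form2 _ _ _ _ (fun x y => (w x y)%:C%C) aE) !(raddfD, raddfN).
rewrite /dc /del /delbar !big_ord_recl !big_ord0 /=.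
have z p q Z : p != 1%N -> bidegree J q (ced (bidegree J p a)) Z = 0.
  by move=> p1; apply: bidegree0 => Y; apply: dE.
rewrite !(z 0%N) // !(z 2%N) // !addr0 !add0r.
rewrite !(eq_bidegree _ _ d1).
rewrite (@bidegree3_diff _ _ _ _ (fun x y z => (dw x y z)%:C%C) daE) /=.
  rewrite -raddfN; congr (_ %:C)%C.
  rewrite /dw /bismut /w !dotJJ; ring.
(* What is left is the hypothesis of [bidegree3_diff] for d omega. It follows from integrability,
   which [h] uses to expand [J u, J v]. *)
rewrite -!raddfD; congr (_ %:C)%C.
set x := X _; set y := X _; set t := X _.
rewrite /dw /w !dotJJ.
have h u v s : met (lieb (J u) (J v)) s =
    met (J (lieb u v)) (J s) + met (J (lieb (J u) v)) s + met (J (lieb u (J v))) s.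
  rewrite dotJJ -addrA -dotDl -linearD /= -nijenhuis_eq dotDl dotNl.
  by rewrite addrC addrNK.
rewrite !h !dotJJ.
ring.
Qed.

Lemma ced_dc_fund_form (X : {ffun 'I_4 -> g}) (B := bismut)
    (x := X (i0 _)) (y := X (i1 _)) (z := X (i2 _)) (u := X (i3 _)) :
  ced (dc J (fun Y => (fund_form J met Y)%:C%C)) X =
  (- B (lieb x y) z u + B (lieb x z) y u - B (lieb y z) x u
   - B (lieb x u) y z + B (lieb y u) x z - B (lieb z u) x y)%:C%C.
Proof.
rewrite (@ced_form3 _ _ _ _ (fun x y z => (B x y z)%:C%C) dc_fund_form).
by rewrite -?(raddfN, raddfD).
Qed.

Lemma skt_bismut x y z u (B := bismut) : skt J met ->
  - B (lieb x y) z u + B (lieb x z) y u - B (lieb y z) x u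
  - B (lieb x u) y z + B (lieb y u) x z - B (lieb z u) x y = 0.
Proof.
move=> /(_ [ffun i : 'I_4 => nth 0 [:: x; y; z; u] i]).
by rewrite ced_dc_fund_form !ffunE => /eqP; rewrite eq_complex eqxx andbT => /eqP.
Qed.

End Hermitian.

(** * Coordinates *)

Section Indices.
Variable n : nat.
Hypothesis n_ge2 : (2 <= n)%N.

(** The cases follow the grouping of the structure equations; [k./2 - 1] recovers l from both 2l + 2
    and 2l + 3. *)
Lemma adapted_index_ind (P : nat -> Prop) :
    P 1%N -> P 2%N -> P 3%N -> P (2 * n)%N ->
    (forall l, (1 <= l <= n - 2)%N -> P (2 * l + 2)%N /\ P (2 * l + 3)%N) ->
  forall k, (1 <= k <= 2 * n)%N -> P k.
Proof.
move=> P1 P2 P3 P4 Pl k /andP[k_gt0 k_le].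
have [k3|k3] := leqP k 3; first by move: k k_gt0 k3 {k_le} => [|[|[|[|]]]].
have [->//|k4] := eqVneq k (2 * n)%N.
have lP : (1 <= k./2 - 1 <= n - 2)%N by lia.
have [Pe Po] := Pl _ lP.
have [ek|ok] : k = (2 * (k./2 - 1) + 2)%N \/ k = (2 * (k./2 - 1) + 3)%N.
  have := odd_double_half k; case: (odd k) => /= ?; [right|left]; lia.
by rewrite ek.
by rewrite ok.
Qed.

Lemma adapted_index_sum (V : nmodType) (F : nat -> V) :
  \sum_(1 <= k < (2 * n).+1) F k = F 1%N + F 2%N + F 3%N + F (2 * n)%N
    + \sum_(1 <= l < n.-1) (F (2 * l + 2)%N + F (2 * l + 3)%N).
Proof.
case: n n_ge2 => [|[|m]] //= _.
have e2 : (2 * m.+2 = (2 * m + 3).+1)%N by lia.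
rewrite e2 big_nat_recr //= [RHS]addrAC; congr (_ + _).
elim: m {e2} => [|m IHm].
  rewrite [in RHS]big_geq // addr0; do 3!rewrite big_ltn //.
  by rewrite big_geq // addr0 addrA.
rewrite [X in _ = _ + X]big_nat_recr //= addrA -IHm.
have -> : (2 * m.+1 + 3)%N = (2 * m + 3).+2 by lia.
have -> : (2 * m.+1 + 2)%N = (2 * m + 3).+1 by lia.
by rewrite big_nat_recr // big_nat_recr //= addrA.
Qed.

End Indices.

Section Coordinates.
Variables (R : realType) (g : lieAlgType R) (m : nat) (f : m.-tuple g).
Implicit Types x y : g.

Notation c := (cov f).

Lemma covD k x y : c k (x + y) = c k x + c k y.
Proof. by rewrite -big_split; apply: eq_bigr => i _; rewrite linearD. Qed.
Lemma covZ k a x : c k (a *: x) = a * c k x.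
Proof. by rewrite big_distrr; apply: eq_bigr => i _; rewrite linearZ. Qed.
Lemma covN k x : c k (- x) = - c k x.
Proof. by rewrite -scaleN1r covZ mulN1r. Qed.
Lemma cov0 k : c k 0 = 0.
Proof. by rewrite -(scale0r 0) covZ mul0r. Qed.
Lemma cov_sum k (I : Type) (r : seq I) (P : pred I) F :
  c k (\sum_(i <- r | P i) F i) = \sum_(i <- r | P i) c k (F i).
Proof. exact: (big_morph (c k) (covD k) (cov0 k)). Qed.

Definition covE := (covD, covZ, covN, cov0).

Hypothesis f_basis : basis_of fullv f.

Lemma covS (i : 'I_m) x : c i.+1 x = coord f i x.
Proof. by rewrite /cov (big_pred1 i) // => j; rewrite eqSS. Qed.

Lemma cov_vec j k : (1 <= j <= m)%N -> (1 <= k <= m)%N ->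
  c k (vec f j) = (j == k)%:R.
Proof.
case: j k => [|j] [|k] //= jm km.
rewrite (covS (Ordinal km)) /vec.
have := coord_free (Ordinal jm) (Ordinal km) (basis_free f_basis).
by rewrite /= eqSS => ->.
Qed.

Lemma cov_expand x : x = \sum_(1 <= k < m.+1) c k x *: vec f k.
Proof.
rewrite [LHS](coord_basis f_basis (memvf x)) big_add1 /= big_mkord.
by apply: eq_bigr => i _; rewrite covS.
Qed.

Lemma cov_eq x y : (forall k, (1 <= k <= m)%N -> c k x = c k y) -> x = y.
Proof.
move=> xy; rewrite (cov_expand x) (cov_expand y).
by apply: eq_big_nat => k km; rewrite xy.
Qed.

Lemma cov_lin k (a : nat -> R) : (1 <= k <= m)%N ->
  c k (\sum_(1 <= j < m.+1) a j *: vec f j) = a k.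
Proof.
move=> km; rewrite cov_sum (bigD1_seq k) ?mem_index_iota ?iota_uniq //=.
rewrite covZ cov_vec // eqxx mulr1 big1_seq ?addr0 // => j /andP[jk].
by rewrite mem_index_iota covZ => jm; rewrite cov_vec // (negPf jk) mulr0.
Qed.

Lemma standard_metric_exists :
  exists met : {dot g for idfun},
    forall x y, met x y = \sum_(1 <= l < m.+1) c l x * c l y.
Proof.
pose d x y := \sum_(1 <= l < m.+1) c l x * c l y.
have dC x y : d x y = d y x by apply: eq_bigr => l _; rewrite mulrC.
have dl x : linear_for *%R (d x).
  move=> a u v; rewrite /d mulr_sumr -big_split; apply: eq_bigr => l _ /=.
  by rewrite !covE; ring.
have dll y : linear_for *%R (d^~ y).
  by move=> a u v; rewrite -[d^~ y _]/(d _ _) dC dl dC (dC y).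
have dherm x y : d x y = (-1) ^+ false * idfun (d y x).
  by rewrite expr0 mul1r dC.
have dpos x : x != 0 -> 0 < d x x.
  move=> x0; rewrite lt_def; apply/andP; split; last first.
    by apply: sumr_ge0 => l _; apply: sqr_ge0.
  apply: contraNneq x0 => /eqP; rewrite psumr_eq0 => [/allP h|l _]; last first.
    exact: sqr_ge0.
  apply/eqP/cov_eq => k km; rewrite cov0; apply/eqP.
  have /(_ _)/implyP := h k; rewrite mem_index_iota => /(_ km isT).
  by rewrite mulf_eq0 orbb.
pose D := HB.pack_for {dot g for idfun} d
  (isBilinear.Build R g g R *%R (idfun \; *%R) d
    (fun y => zmod_morphism_linear (dll y)) (fun x => zmod_morphism_linear (dl x))
    (fun y => scalable_linear (dll y)) (fun x => scalable_linear (dl x)))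
  (isHermitianSesquilinear.Build R g false idfun d dherm)
  (isDotProduct.Build R g d dpos).
by exists D.
Qed.

End Coordinates.

Section Frame.
Variables (R : realType) (n : nat) (g : lieAlgType R) (f : (2 * n).-tuple g).
Hypothesis f_basis : basis_of fullv f.
Hypothesis n_ge2 : (2 <= n)%N.
Implicit Types x y : g.

Notation c := (cov f).
Notation v := (vec f).
Notation t := (cov f (2 * n)).

Definition of_cov (a : nat -> R) : g := \sum_(1 <= k < (2 * n).+1) a k *: v k.

Lemma cov_of_cov k a : (1 <= k <= 2 * n)%N -> c k (of_cov a) = a k.
Proof. exact: cov_lin. Qed.

Lemma adapted_eq x y :
    c 1 x = c 1 y -> c 2 x = c 2 y -> c 3 x = c 3 y -> t x = t y ->
    (forall l, (1 <= l <= n - 2)%N ->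
      c (2 * l + 2) x = c (2 * l + 2) y /\ c (2 * l + 3) x = c (2 * l + 3) y) ->
  x = y.
Proof.
move=> *; apply: (cov_eq f_basis) => k km.
exact: (adapted_index_ind n_ge2 (P := fun k => c k x = c k y)) km.
Qed.

(* ae l and ao l are the coordinates of indices 2l + 2 and 2l + 3. *)
Definition coords (a1 a2 a3 at_ : R) (ae ao : nat -> R) : g :=
  of_cov (fun k => if k == 1%N then a1 else if k == 2%N then a2
    else if k == 3%N then a3 else if k == (2 * n)%N then at_
    else if odd k then ao (k./2 - 1)%N else ae (k./2 - 1)%N).

Section Coords.
Variables (a1 a2 a3 at_ : R) (ae ao : nat -> R).
Let x := coords a1 a2 a3 at_ ae ao.

Lemma cov1_coords : c 1 x = a1.
Proof. by rewrite cov_of_cov //; lia. Qed.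
Lemma cov2_coords : c 2 x = a2.
Proof. by rewrite cov_of_cov //; lia. Qed.
Lemma cov3_coords : c 3 x = a3.
Proof. by rewrite cov_of_cov //; lia. Qed.
Lemma covt_coords : t x = at_.
Proof.
rewrite cov_of_cov; last by lia.
have [-> -> ->] : [/\ (2 * n == 1) = false, (2 * n == 2) = false
  & (2 * n == 3) = false]%N by split; lia.
by rewrite eqxx.
Qed.
Lemma cove_coords l : (1 <= l <= n - 2)%N -> c (2 * l + 2) x = ae l.
Proof.
move=> lP; rewrite cov_of_cov; last by lia.
have [-> -> -> ->] : [/\ (2 * l + 2 == 1) = false, (2 * l + 2 == 2) = false,
  (2 * l + 2 == 3) = false & (2 * l + 2 == 2 * n) = false]%N by split; lia.
have -> : odd (2 * l + 2) = false by lia.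
by congr ae; lia.
Qed.
Lemma covo_coords l : (1 <= l <= n - 2)%N -> c (2 * l + 3) x = ao l.
Proof.
move=> lP; rewrite cov_of_cov; last by lia.
have [-> -> -> ->] : [/\ (2 * l + 3 == 1) = false, (2 * l + 3 == 2) = false,
  (2 * l + 3 == 3) = false & (2 * l + 3 == 2 * n) = false]%N by split; lia.
have -> : odd (2 * l + 3) = true by lia.
by congr ao; lia.
Qed.
End Coords.

Let coordsE := (cov1_coords, cov2_coords, cov3_coords, covt_coords,
  cove_coords, covo_coords).

Notation z_ := (fun _ : nat => 0 : R).

Ltac cov_check := apply: adapted_eq; [| | | |
  let j := fresh "j" in let jP := fresh "jP" in move=> j jP; split];
  rewrite ?coordsE //.

Let cv1 k : (1 <= k <= 2 * n)%N -> c k (v k) = 1.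
Proof. by move=> kP; rewrite cov_vec // eqxx. Qed.

Let cv0 j k : (1 <= j <= 2 * n)%N -> (1 <= k <= 2 * n)%N -> j <> k ->
  c k (v j) = 0.
Proof. by move=> jP kP /eqP/negPf jk; rewrite cov_vec // jk. Qed.

Ltac vec_check := cov_check;
  first [by rewrite ?covN cv1 ?oppr0; [|lia]
        |by rewrite ?covN cv0 ?oppr0; [|lia|lia|lia]].

Lemma vec1E : v 1 = coords 1 0 0 0 z_ z_. Proof. vec_check. Qed.
Lemma vec2E : v 2 = coords 0 1 0 0 z_ z_. Proof. vec_check. Qed.
Lemma vec3E : v 3 = coords 0 0 1 0 z_ z_. Proof. vec_check. Qed.
Lemma vectE : v (2 * n) = coords 0 0 0 1 z_ z_. Proof. vec_check. Qed.
Lemma veceE l : (1 <= l <= n - 2)%N ->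
  v (2 * l + 2) = coords 0 0 0 0 (fun j => (j == l)%:R) z_.
Proof.
move=> lP; cov_check; try by rewrite cv0 //; lia.
by have [->|jl] := eqVneq j l; [rewrite cv1 //|rewrite cv0 //]; lia.
Qed.
Lemma vecoE l : (1 <= l <= n - 2)%N ->
  v (2 * l + 3) = coords 0 0 0 0 z_ (fun j => (j == l)%:R).
Proof.
move=> lP; cov_check; try by rewrite cv0 //; lia.
by have [->|jl] := eqVneq j l; [rewrite cv1 //|rewrite cv0 //]; lia.
Qed.

End Frame.

(** * Direct sums and quotients *)

Section Decomposable.
Variables (K : fieldType) (g : lieAlgType K).
Implicit Types U W : {vspace g}.

Section SubLie.
Variable U : {vspace g}.
Hypothesis U_closed : {in U &, forall x y, lieb x y \in U}.

Let br (x y : subvs_of U) : subvs_of U := vsproj U (lieb (vsval x) (vsval y)).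

Let brE x y : vsval (br x y) = lieb (vsval x) (vsval y).
Proof. by rewrite vsprojK // U_closed ?subvsP. Qed.

Let br_linearl y : linear (br ^~ y).
Proof.
by move=> a u v; apply: subvs_inj; rewrite linearP /= !brE linearP /= !liebE.
Qed.

Let br_linearr x : linear (br x).
Proof.
by move=> a u v; apply: subvs_inj; rewrite linearP /= !brE linearP /= !liebE.
Qed.

Let brxx x : br x x = 0.
Proof. by apply: subvs_inj; rewrite brE liebxx linear0. Qed.

Let br_jacobi x y z : br x (br y z) + br y (br z x) + br z (br x y) = 0.
Proof. by apply: subvs_inj; rewrite linear0 !linearD /= !brE lieb_jacobi. Qed.

Definition sub_lieAlg : lieAlgType K := HB.pack_for (lieAlgType K) (subvs_of U)
  (Vector_isLieAlg.Build K (subvs_of U) br_linearl br_linearr brxx br_jacobi).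

Definition sub_val : sub_lieAlg -> g := @vsval K g U.

Lemma sub_valE x y : sub_val (lieb x y) = lieb (sub_val x) (sub_val y).
Proof. exact: brE. Qed.

Lemma dim_sub_lieAlg : \dim {:sub_lieAlg} = \dim U.
Proof. by rewrite dimvf. Qed.

Lemma sub_lieAlg_proj (p : 'End(g)) : (forall x, p x \in U) ->
  exists q : 'Hom(g, sub_lieAlg), forall x, sub_val (q x) = p x.
Proof.
move=> pU.
have q_lin : linear (fun x => vsproj U (p x) : sub_lieAlg).
  by move=> a u v; rewrite linearP linearP.
have [q qE] := linear_lfun q_lin; exists q => x.
by rewrite qE /sub_val vsprojK.
Qed.

End SubLie.

(** The projections onto [U] and [W] are the components of the isomorphism; they respect brackets
    because the cross brackets vanish. *)
Lemma decomposable_split U W :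
    {in U &, forall x y, lieb x y \in U} -> {in W &, forall x y, lieb x y \in W} ->
    {in U & W, forall x y, lieb x y = 0} ->
    (U + W)%VS = fullv -> (U :&: W)%VS = 0%VS -> U != 0%VS -> W != 0%VS ->
  decomposable g.
Proof.
move=> Uc Wc UW fullUW UW0 U0 W0.
have [p pE] := sub_lieAlg_proj Uc (memv_pi U W).
have [q qE] := sub_lieAlg_proj Wc (memv_pi W U).
have WU0 : (W :&: U)%VS = 0%VS by rewrite capvC.
have pqE x : x = sub_val (p x) + sub_val (q x).
  by rewrite pE qE daddv_pi_add // fullUW memvf.
have pU x : sub_val (p x) \in U by apply: subvsP.
have qW x : sub_val (q x) \in W by apply: subvsP.
have uniq u w : u \in U -> w \in W ->
    sub_val (p (u + w)) = u /\ sub_val (q (u + w)) = w.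
  move=> uU wW; have dUW : directv (U + W) by apply/directv_addP.
  have := directv_add_unique dUW _ _ _ _ (pU (u + w)) uU (qW (u + w)) wW.
  by rewrite -pqE eqxx => /esym /eqP[-> ->].
have phi_lin : linear (fun x => (p x, q x) : (sub_lieAlg Uc * sub_lieAlg Wc)%type).
  by move=> a u v; rewrite !linearP.
have [phi phiE] := linear_lfun phi_lin.
exists (sub_lieAlg Uc), (sub_lieAlg Wc).
split; rewrite ?dim_sub_lieAlg ?lt0n ?dimv_eq0 //; exists phi.
  exists (fun y => sub_val y.1 + sub_val y.2) => [x|[u w]].
    by rewrite phiE -pqE.
  rewrite phiE /=; have [] := uniq _ _ (subvsP u) (subvsP w).
  by move=> /subvs_inj -> /subvs_inj ->.
move=> x y; rewrite !phiE /=.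
have -> : lieb x y = lieb (sub_val (p x)) (sub_val (p y))
                     + lieb (sub_val (q x)) (sub_val (q y)).
  have xy : lieb (sub_val (p x)) (sub_val (q y)) = 0 by apply: UW.
  have yx : lieb (sub_val (q x)) (sub_val (p y)) = 0 by rewrite liebC UW ?oppr0.
  rewrite {1}(pqE x) {1}(pqE y) liebDl !liebDr xy yx.
  by rewrite addr0 add0r.
by congr pair; apply: subvs_inj; rewrite -[LHS]/(sub_val _) -[RHS]/(sub_val _)
  sub_valE; have [] := uniq _ _ (Uc _ _ (pU x) (pU y)) (Wc _ _ (qW x) (qW y)).
Qed.

End Decomposable.

Section SolvableQuotient.
Variables (K : fieldType) (g h : lieAlgType K) (p : 'Hom(g, h)).
Hypothesis p_morph : forall x y, p (lieb x y) = lieb (p x) (p y).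

Lemma lieS_quotient x : x \in lieS {:g} {:g} -> p x \in lieS {:h} {:h}.
Proof.
rewrite memv_preim; apply/subvP/lieS_subP => u w _ _.
by rewrite -memv_preim p_morph lieb_lieS ?memvf.
Qed.

Hypothesis p_surj : forall y, exists x, p x = y.

Lemma derived_series_quotient l :
  (derived_series h l <= p @: derived_series g l)%VS.
Proof.
elim: l => [|l /subvP IHl] /=.
  by apply/subvP => y _; have [x <-] := p_surj y; rewrite memv_img ?memvf.
apply/lieS_subP => u w /IHl /memv_imgP[x xD ->] /IHl /memv_imgP[y yD ->].
by rewrite -p_morph memv_img // lieb_lieS.
Qed.

(** The derived series of a perfect [h] would be constant, whereas each of its terms lies in the
    image of the corresponding term for [g], which reaches 0. *)
Lemma solvable_quotient_not_perfect : solvable_lie g -> (0 < \dim {:h})%N ->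
  lieS {:h} {:h} != fullv.
Proof.
move=> [l gl0] h_gt0; apply: contraTneq h_gt0 => h_perfect.
have hl : derived_series h l = fullv by elim: l {gl0} => //= l ->.
have := derived_series_quotient l.
by rewrite hl gl0 limg0 subv0 => /eqP ->; rewrite dimv0.
Qed.

End SolvableQuotient.

(** * Lie algebras with an adapted basis *)

(** [cov] is a bare function; this provides its kernel as a subspace, to which the lemmas on spans
    and dimensions apply. *)
Lemma cov_ker (R : realType) (g : lieAlgType R) m (f : m.-tuple g) k :
  exists W : {vspace g}, forall x, (x \in W) = (cov f k x == 0).
Proof.
have c_lin : linear (cov f k : g -> R^o).
  by move=> a x y; rewrite !covE.
by have [F FE] := linear_lfun c_lin; exists (lker F) => x; rewrite memv_ker FE.
Qed.

Section Adapted.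
Variables (R : realType) (n : nat) (g : lieAlgType R).
Variables (f : (2 * n).-tuple g) (b : nat -> R).
Hypothesis n_ge2 : (2 <= n)%N.
Hypothesis fP : adapted_basis f b.
Implicit Types (x y z : g) (N : {vspace g}).

Notation c := (cov f).
Notation v := (vec f).
Notation t := (cov f (2 * n)).

Let f_basis : basis_of fullv f. Proof. by case: fP. Qed.

Let X2 x y : {ffun 'I_2 -> g} := [ffun i => if i == ord0 then x else y].

(** Since d alpha(X, Y) = - alpha([X, Y]) on 1-forms, each structure equation gives one coordinate
    of the bracket. *)
Let d_wedge k (F : g -> g -> R) : (forall X : {ffun 'I_2 -> g},
    ced (form1 (c k)) X = F (X ord0) (X ord_max)) ->
  forall x y, c k (lieb x y) = - F x y.
Proof.
by move=> h x y; have := h (X2 x y); rewrite ced_form1 !ffunE /= => <-;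
  rewrite opprK.
Qed.

Lemma cov1_lieb x y : c 1 (lieb x y) = c 3 x * c 2 y - c 2 x * c 3 y.
Proof.
have [_ [h _ _ _] _] := fP.
by rewrite (d_wedge (F := fun x y => c 2 x * c 3 y - c 2 y * c 3 x)) //; ring.
Qed.

Lemma cov2_lieb x y : c 2 (lieb x y) = c 2 x * t y - t x * c 2 y.
Proof.
have [_ [_ h _ _] _] := fP.
by rewrite (d_wedge (F := fun x y => - (c 2 x * t y - c 2 y * t x))) //; ring.
Qed.

Lemma cov3_lieb x y : c 3 (lieb x y) = t x * c 3 y - c 3 x * t y.
Proof.
have [_ [_ _ h _] _] := fP.
by rewrite (d_wedge (F := fun x y => c 3 x * t y - c 3 y * t x)) //; ring.
Qed.

Lemma covt_lieb x y : t (lieb x y) = 0.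
Proof.
have [_ [_ _ _ h] _] := fP.
by rewrite (d_wedge (F := fun _ _ => 0)) ?oppr0.
Qed.

Lemma cove_lieb l x y : (1 <= l <= n - 2)%N ->
  c (2 * l + 2) (lieb x y) = b l * (t x * c (2 * l + 3) y - c (2 * l + 3) x * t y).
Proof.
move=> lP; have [_ _ /(_ l lP)[h _]] := fP.
rewrite (d_wedge (F := fun x y => b l *
  (c (2 * l + 3) x * t y - c (2 * l + 3) y * t x))) //; ring.
Qed.

Lemma covo_lieb l x y : (1 <= l <= n - 2)%N ->
  c (2 * l + 3) (lieb x y) = b l * (c (2 * l + 2) x * t y - t x * c (2 * l + 2) y).
Proof.
move=> lP; have [_ _ /(_ l lP)[_ h]] := fP.
rewrite (d_wedge (F := fun x y => - b l *
  (c (2 * l + 2) x * t y - c (2 * l + 2) y * t x))) //; ring.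
Qed.

Notation coords := (coords f).
Let coordsE := (cov1_coords f_basis n_ge2, cov2_coords f_basis n_ge2,
  cov3_coords f_basis n_ge2, covt_coords f_basis n_ge2,
  cove_coords f_basis n_ge2, covo_coords f_basis n_ge2).
Let cov_liebE := (cov1_lieb, cov2_lieb, cov3_lieb, covt_lieb,
  cove_lieb, covo_lieb).

Notation z_ := (fun _ : nat => 0 : R).
Let E1 := coords 1 0 0 0 z_ z_.
Let E2 := coords 0 1 0 0 z_ z_.
Let E3 := coords 0 0 1 0 z_ z_.
Let Et := coords 0 0 0 1 z_ z_.

Ltac cov_simpl := rewrite ?(covE, cov_liebE, coordsE) //.
Ltac cov_check := apply: (adapted_eq f_basis n_ge2); [| | | |
  let j := fresh "j" in let jP := fresh "jP" in move=> j jP; split];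
  cov_simpl.

Lemma lieb32 : lieb E3 E2 = E1.
Proof. by cov_check; ring. Qed.

Lemma liebt2 : lieb E2 Et = E2.
Proof. by cov_check; ring. Qed.

Lemma liebt3 : lieb Et E3 = E3.
Proof. by cov_check; ring. Qed.

Lemma lieb1l x : lieb E1 x = 0.
Proof. by cov_check; ring. Qed.

Lemma coords1_neq0 : E1 != 0.
Proof.
apply: contra_neq (oner_neq0 R) => E10.
by rewrite -(cov0 f 1) -E10 (cov1_coords f_basis n_ge2).
Qed.

(** When no b_l vanishes, ad f_{2n} is invertible on the span of f_2, ..., f_{2n-1}; moreover f_1 =
    [f_3, f_2]. *)
Lemma ker_cov_derived x : (forall l, (1 <= l <= n - 2)%N -> b l != 0) ->
  t x = 0 -> x \in lieS {:g} {:g}.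
Proof.
move=> b0 tx.
(* [u] is the preimage, under bracketing with [Et], of [x] without its f_1-component: each rotation
   block is inverted by a quarter turn and a division by b_l. *)
pose u := coords 0 (c 2 x) (- c 3 x) 0
  (fun l => c (2 * l + 3) x / b l) (fun l => - c (2 * l + 2) x / b l).
suff -> : x = lieb u Et + lieb (c 1 x *: E3) E2.
  by rewrite rpredD // lieb_lieS ?memvf.
by cov_check; rewrite ?tx; try ring; field; exact: b0.
Qed.

(** Brackets have no f_{2n}-component, brackets of those have no f_2-component either, and after
    that every bracket vanishes. Conversely f_2 and f_3 are in the first derived algebra, hence f_1
    = [f_3, f_2] is in the second. *)
Lemma adapted_step_solvable : step_solvable g 3.
Proof.
have [K2 K2E] := cov_ker f 2; have [Kt KtE] := cov_ker f (2 * n).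
have D1 : (derived_series g 1 <= Kt)%VS.
  by apply/lieS_subP => x y _ _; rewrite KtE covt_lieb.
have D2 : (derived_series g 2 <= K2 :&: Kt)%VS.
  apply/lieS_subP => x y /(subvP D1) + /(subvP D1).
  rewrite !KtE => /eqP tx /eqP ty.
  by rewrite memv_cap K2E KtE !cov_liebE tx ty !(mulr0, mul0r) subr0 eqxx.
have E23 : E2 \in derived_series g 1 /\ E3 \in derived_series g 1.
  by rewrite -liebt2 -liebt3 !lieb_lieS ?memvf.
have E1D : E1 \in derived_series g 2.
  by rewrite -lieb32 lieb_lieS; case: E23.
split.
  apply/eqP; rewrite -subv0; apply/lieS_subP => x y /(subvP D2) + /(subvP D2).
  rewrite !memv_cap !K2E !KtE memv0 => /andP[/eqP x2 /eqP tx] /andP[/eqP y2 /eqP ty].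
  by apply/eqP; cov_check; rewrite ?tx ?ty ?x2 ?y2; ring.
have E10 := coords1_neq0.
have E20 : E2 != 0.
  apply/eqP => /(congr1 (c 2)); rewrite cov0 (cov2_coords f_basis n_ge2) => /eqP.
  by rewrite oner_eq0.
move=> [|[|[|//]]] _ D0.
- by have := memvf E1; rewrite [fullv]D0 memv0 (negPf E10).
- by case: E23; rewrite D0 memv0 (negPf E20).
- by move: E1D; rewrite D0 memv0 (negPf E10).
Qed.

(** If b_l = 0, then f_{2l+2} is central and f^{2l+2} vanishes on all brackets, so that its kernel
    is a complementary subalgebra. *)
Lemma adapted_decomposable_zero l : (1 <= l <= n - 2)%N -> b l = 0 ->
  decomposable g.
Proof.
move=> lP bl.
have [U UE] := cov_ker f (2 * l + 2).
pose e := v (2 * l + 2).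
have ke k : (1 <= k <= 2 * n)%N -> c k e = (2 * l + 2 == k)%N%:R.
  by move=> kP; rewrite cov_vec //; lia.
have e1 : c (2 * l + 2) e = 1 by rewrite ke ?eqxx //; lia.
have ek k : (1 <= k <= 2 * n)%N -> k != (2 * l + 2)%N -> c k e = 0.
  by move=> kP kl; rewrite ke // eq_sym (negPf kl).
have ec x : lieb x e = 0.
  apply: (adapted_eq f_basis n_ge2) => [||||j jP]; last split;
    cov_simpl; rewrite ?cov0.
  - by rewrite !ek ?mulr0 ?subrr //; lia.
  - by rewrite !ek ?mulr0 ?subrr //; lia.
  - by rewrite !ek ?mulr0 ?subrr //; lia.
  - by rewrite !ek ?mulr0 ?subrr ?mulr0 //; lia.
  have [->|jl] := eqVneq j l; first by rewrite bl mul0r.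
  by rewrite !ek ?mulr0 ?subrr ?mulr0 //; lia.
apply: (@decomposable_split _ _ U <[e]>%VS).
- by move=> x y _ _; rewrite UE cove_lieb // bl mul0r.
- by move=> x y _ /vlineP[k ->]; rewrite liebZr ec scaler0 mem0v.
- by move=> x y _ /vlineP[k ->]; rewrite liebZr ec scaler0.
- apply/vspaceP => x; rewrite memvf; apply/memv_addP.
  exists (x - c (2 * l + 2) x *: e); first by rewrite UE !covE e1 mulr1 subrr.
  by exists (c (2 * l + 2) x *: e); rewrite ?subrK // memvZ ?memv_line.
- apply/eqP; rewrite -subv0; apply/subvP => x; rewrite memv_cap UE memv0.
  move=> /andP[/eqP + /vlineP[k xk]].
  by rewrite xk covZ e1 mulr1 => ->; rewrite scale0r.
- apply: contraNneq coords1_neq0 => U0.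
  by rewrite -memv0 -U0 UE (cove_coords f_basis n_ge2).
- apply/eqP => e0; have := memv_line e; rewrite e0 memv0 => /eqP e00.
  by move/eqP: e1; rewrite e00 cov0 eq_sym oner_eq0.
Qed.

Lemma adapted_decomposable : decomposable g ->
  exists2 l, (1 <= l <= n - 2)%N & b l = 0.
Proof.
move=> [g1 [g2 [g1_gt0 g2_gt0 [phi [psi phiK psiK] phi_morph]]]].
have g_sol : solvable_lie g.
  by exists 3%N; case: adapted_step_solvable.
have p1_lin : linear (fun x => (phi x).1) by move=> a x y; rewrite linearP.
have p2_lin : linear (fun x => (phi x).2) by move=> a x y; rewrite linearP.
have [p pE] := linear_lfun p1_lin; have [q qE] := linear_lfun p2_lin.
have p_morph x y : p (lieb x y) = lieb (p x) (p y) by rewrite !pE phi_morph.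
have q_morph x y : q (lieb x y) = lieb (q x) (q y) by rewrite !qE phi_morph.
have p_surj (y : g1) : exists x, p x = y by exists (psi (y, 0)); rewrite pE psiK.
have q_surj (y : g2) : exists x, q x = y by exists (psi (0, y)); rewrite qE psiK.
have [/hasP[l + /eqP bl]|/hasPn b0] :=
  boolP (has (fun l => b l == 0) (iota 1 (n - 2))).
  by rewrite mem_iota => lP; exists l => //; lia.
have nder x : t x = 0 -> x \in lieS {:g} {:g}.
  by apply: ker_cov_derived => l lP; apply: b0; rewrite mem_iota; lia.
have split_t x : exists2 y, t y = 0 & x = y + t x *: Et.
  exists (x - t x *: Et); last by rewrite subrK.
  by rewrite !covE (covt_coords f_basis n_ge2); ring.
(* The image of [g] is spanned by that of [Et] and that of the kernel of f^{2n}, which lies in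
   [g, g]. If [r Et] were derived too, [h] would be perfect. *)
have not_derived (h : lieAlgType R) (r : 'Hom(g, h)) : (0 < \dim {:h})%N ->
    (forall x y, r (lieb x y) = lieb (r x) (r y)) ->
    (forall y : h, exists x, r x = y) -> r Et \notin lieS {:h} {:h}.
  move=> h_gt0 r_morph r_surj.
  have := solvable_quotient_not_perfect r_morph r_surj g_sol h_gt0.
  apply: contraNN => rEt; apply/eqP/vspaceP => y; rewrite memvf.
  have [x <-] := r_surj y; have [u tu ->] := split_t x.
  by rewrite linearD linearZ /= rpredD ?rpredZ // (lieS_quotient r_morph) ?nder.
have pEt := not_derived _ _ g1_gt0 p_morph p_surj.
have qEt := not_derived _ _ g2_gt0 q_morph q_surj.
(* [x] agrees with [Et] in the first factor and is 0 in the second. If [t x] is zero then [p Et] is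
   derived, otherwise [q Et] is; both are impossible. *)
pose x := psi (p Et, 0); have px : p x = p Et by rewrite pE psiK.
have qx : q x = 0 by rewrite qE psiK.
suff tx : t x = 0 by case/negP: pEt; rewrite -px (lieS_quotient p_morph) ?nder.
apply: contraNeq qEt => tx.
have : t x *: q Et \in lieS {:g2} {:g2}.
  have [u tu xE] := split_t x; move/eqP: qx; rewrite {1}xE linearD linearZ /=.
  by rewrite addrC addr_eq0 => /eqP ->; rewrite rpredN (lieS_quotient q_morph) ?nder.
by move/(rpredZ (t x)^-1); rewrite scalerA mulVf // scale1r.
Qed.

(** If [y] in [N] had [t y] nonzero, each application of ad y would multiply the f_2-coordinate by
    [- t y], against nilpotency. So [N] lies in the kernel of f^{2n}, and dimensions give
    equality. *)
Lemma adapted_nilradical N : almost_nilpotent N -> forall x, (x \in N) = (t x == 0).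
Proof.
move=> [_ [/is_idealP N_ideal [l Nl] _] dimN].
have [K KE] := cov_ker f (2 * n).
suff NK : N = K by move=> x; rewrite NK KE.
have sNK : (N <= K)%VS.
  apply/subvP => y yN; rewrite KE; apply: contraT => ty.
  (* Starting from [y, E2] instead of [E2] puts [w 0] in the ideal [N]. *)
  pose w k := iter k (lieb y) (lieb y E2).
  have wP k : w k \in lcs N k /\ (t (w k) = 0 /\ c 2 (w k) != 0).
    elim: k => [|k [wN [tw cw]]].
      split; first by rewrite /w /= liebC memvN N_ideal.
      by rewrite /w /= !cov_liebE !coordsE mulr0 mulr1 sub0r oppr_eq0.
    split; first exact: lieb_lieS.
    rewrite -[w _]/(lieb y (w k)) !cov_liebE tw mulr0 sub0r oppr_eq0 mulf_neq0 //.
  have [+ [_ cw]] := wP l; rewrite Nl memv0 => /eqP w0.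
  by move: cw; rewrite w0 cov0 eqxx.
apply/eqP; rewrite eqEdim sNK -ltnS dimN ltn_neqAle dimvS ?subvf // andbT.
apply/eqP => dimK; have /eqP KF : K == fullv by rewrite eqEdim subvf dimK leqnn.
have := memvf Et; rewrite -KF KE (covt_coords f_basis n_ge2).
by rewrite oner_eq0.
Qed.

Lemma lcs1_adapted N : (forall x, (x \in N) = (t x == 0)) ->
  lcs N 1 = <[E1]>%VS.
Proof.
move=> NE; apply/eqP; rewrite eqEsubv; apply/andP; split.
  apply/lieS_subP => x y; rewrite !NE => /eqP tx /eqP ty; apply/vlineP.
  exists (c 1 (lieb x y)).
  by cov_check; rewrite ?tx ?ty; ring.
by rewrite -memvE -lieb32 lieb_lieS // NE coordsE.
Qed.

(** * Absence of Kaehler structures *)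

Section NoKaehler.
Variables (J : 'End(g)) (met : {dot g for idfun}).
Hypothesis herm : hermitian_structure J met.
Hypothesis kae : kaehler J met.

Let dw0 x y z : - met (J (lieb x y)) z + met (J (lieb x z)) y
  - met (J (lieb y z)) x = 0.
Proof.
pose X : {ffun 'I_3 -> g} := [ffun i : 'I_3 => nth 0 [:: x; y; z] i].
by have := kae X; rewrite ced_fund_form !ffunE.
Qed.

(** Two of the three terms of d omega(x, y, z) contain a bracket with the central [z]. *)
Lemma J_center_orth z x y : (forall u, lieb z u = 0) ->
  met (J z) (lieb x y) = 0.
Proof.
move=> z0; have := dw0 x y z.
rewrite [lieb x z]liebC [lieb y z]liebC !z0 oppr0 linear0 !dot0l addr0 subr0.
by rewrite (dotJl herm) opprK dotC.
Qed.

Lemma ad_J_center z x : (forall u, lieb z u = 0) ->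
  lieb (J z) (J x) = J (lieb (J z) x).
Proof.
by move=> z0; have := nijenhuis_eq herm z x; rewrite !z0 subr0 addr0.
Qed.

Let x0 := J E1.

Let x0_orth x y : met x0 (lieb x y) = 0.
Proof. exact: J_center_orth lieb1l. Qed.

Let x0J x : lieb x0 (J x) = J (lieb x0 x).
Proof. exact: ad_J_center lieb1l. Qed.

Let x0_neq0 : x0 != 0.
Proof.
apply: contraNneq coords1_neq0 => x00.
have := JJ herm E1; rewrite -/x0 x00 linear0 => /eqP.
by rewrite eq_sym oppr_eq0.
Qed.

(** Otherwise ad(J E1) vanishes, first on the kernel of f^{2n} and then on [Et], and d omega at (J
    E1, E3, E2) reduces to - |E1|^2. *)
Lemma kaehler_t_neq0 : t x0 != 0.
Proof.
apply/eqP => t0.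
have ad0 y : t y = 0 -> lieb x0 y = 0.
  move=> ty; have yE : lieb x0 y = c 1 (lieb x0 y) *: E1.
    by cov_check; rewrite ?t0 ?ty; ring.
  (* [x0, J y] = J [x0, y] is a multiple of J E1 = x0, but [x0] is orthogonal to all brackets. *)
  have := x0_orth x0 (J y); rewrite x0J yE linearZ -/x0 dotZr => /eqP.
  by rewrite mulf_eq0 dot_eq0 (negPf x0_neq0) orbF => /eqP ->; rewrite scale0r.
have adE y : lieb x0 y = t y *: lieb x0 Et.
  apply/eqP; rewrite -subr_eq0 -liebZr -liebNr -liebDr ad0 //.
  by rewrite !covE (covt_coords f_basis n_ge2); ring.
have adt : lieb x0 Et = 0.
  set w := lieb x0 Et.
  have Jw : J w = t (J Et) *: w by rewrite -adE x0J.
  (* [J w] is a real multiple of [w], which J^2 = - id allows only for w = 0. *)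
  have /eqP : w + t (J Et) ^+ 2 *: w = 0.
    by rewrite expr2 -scalerA -Jw -linearZ /= -Jw (JJ herm) subrr.
  rewrite -{1}[w]scale1r -scalerDl scaler_eq0 => /orP[|/eqP //].
  by rewrite gt_eqF // ltr_wpDr ?sqr_ge0 ?ltr01.
have ad0' y : lieb x0 y = 0 by rewrite adE adt scaler0.
have := dw0 x0 E3 E2; rewrite !ad0' linear0 !dot0l oppr0 !add0r.
rewrite lieb32 /x0 dotJJ // => /eqP; rewrite oppr_eq0 dot_eq0.
by rewrite (negPf coords1_neq0).
Qed.

(** The eigenspace of ad(J E1) for [- a] is the line of [u]. It is stable under [J], so [J] would
    have a real eigenvalue. *)
Lemma adapted_not_kaehler : False.
Proof.
have a0 := kaehler_t_neq0; set a := t x0 in a0.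
(* The f_1-component compensates the multiple of f_1 that arises in [x0, f_2]. *)
pose u := coords (- c 3 x0 / a) 1 0 0 z_ z_.
have adu : lieb x0 u = - a *: u.
  by cov_check; rewrite -/a; try ring; field.
pose y := J u.
have ady : lieb x0 y = - a *: y by rewrite /y x0J adu linearZ.
have ck k : c k (lieb x0 y) = - a * c k y by rewrite ady covZ.
have na : - a != 0 by rewrite oppr_eq0.
have ty : t y = 0.
  by apply/(mulfI na); rewrite -ck covt_lieb mulr0.
have y3 : c 3 y = 0.
  have := ck 3; rewrite cov3_lieb ty -/a => h.
  apply/(mulfI a0); lra.
have y12 : c 1 y = - c 3 x0 / a * c 2 y.
  have := ck 1%N; rewrite cov1_lieb y3 mulr0 subr0 => h.
  by apply/(mulfI na); rewrite -h; field.
(* On each block the eigenvalue equation is a linear system of determinant a^2 (1 + b_l^2), which is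
   nonzero. *)
have yeo l : (1 <= l <= n - 2)%N -> c (2 * l + 2) y = 0 /\ c (2 * l + 3) y = 0.
  move=> lP; have := ck (2 * l + 2)%N; have := ck (2 * l + 3)%N.
  rewrite cove_lieb // covo_lieb // ty -/a !mulr0 subr0 sub0r.
  set p := c _ y; set q := c _ y => ho he.
  have hq : q = b l * p by apply/(mulfI na); rewrite -ho; ring.
  have hp : p = - (b l * q) by apply/(mulfI na); rewrite -he; ring.
  have p0 : p * (1 + b l ^+ 2) = 0.
    have -> : p * (1 + b l ^+ 2) = p + b l * (b l * p) by ring.
    by rewrite -hq {1}hp addNr.
  move/eqP: p0; rewrite mulf_eq0 [X in _ || X]gt_eqF ?orbF; last first.
    by rewrite ltr_wpDr ?sqr_ge0 ?ltr01.
  by move/eqP => p0; rewrite hq p0 mulr0.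
have yu : y = c 2 y *: u.
  apply: (adapted_eq f_basis n_ge2) => [||||l lP].
  - by rewrite covZ (cov1_coords f_basis n_ge2) y12; ring.
  - by rewrite covZ (cov2_coords f_basis n_ge2) mulr1.
  - by rewrite covZ (cov3_coords f_basis n_ge2) mulr0.
  - by rewrite covZ (covt_coords f_basis n_ge2) mulr0.
  by have [-> ->] := yeo l lP; rewrite !covZ !coordsE ?mulr0.
have Jy : J y = - u by rewrite (JJ herm).
have : c 2 (J y) = c 2 y ^+ 2.
  by rewrite {1}yu linearZ /= -/y covZ.
rewrite Jy covN (cov2_coords f_basis n_ge2) => h.
by have := sqr_ge0 (c 2 y); rewrite -h; lra.
Qed.

End NoKaehler.

(** These coordinates are dictated by J f_1 = - f_2, J f_2 = f_1, J f_3 = f_{2n}, J f_{2n} = - f_3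
    and the quarter turns of the planes of f_{2l+2} and f_{2l+3}. *)
Lemma standard_J_exists : exists J : 'End(g), forall x,
  J x = coords (c 2 x) (- c 1 x) (- t x) (c 3 x)
    (fun l => - c (2 * l + 3) x) (fun l => c (2 * l + 2) x).
Proof.
apply: linear_lfun => a x y.
by apply: (adapted_eq f_basis n_ge2) => [||||l lP]; last split; cov_simpl; ring.
Qed.

(** * The standard SKT structure *)

Section Standard.
Variables (J : 'End(g)) (met : {dot g for idfun}).
Hypothesis JE : forall x, J x = coords (c 2 x) (- c 1 x) (- t x) (c 3 x)
  (fun l => - c (2 * l + 3) x) (fun l => c (2 * l + 2) x).
Hypothesis metE : standard_metric f met.

Let metS x y : met x y = c 1 x * c 1 y + c 2 x * c 2 y + c 3 x * c 3 y
  + t x * t y + \sum_(1 <= l < n.-1)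
    (c (2 * l + 2) x * c (2 * l + 2) y + c (2 * l + 3) x * c (2 * l + 3) y).
Proof. by rewrite metE adapted_index_sum. Qed.

Let sum_range l : (1 <= l < n.-1)%N -> (1 <= l <= n - 2)%N.
Proof. lia. Qed.

Ltac J_simpl := rewrite ?(JE, covE, cov_liebE, coordsE) //.
Ltac J_check := apply: (adapted_eq f_basis n_ge2); [| | | |
  let j := fresh "j" in let jP := fresh "jP" in move=> j jP; split]; J_simpl.

Lemma standard_hermitian : hermitian_structure J met.
Proof.
split=> [x|x y|x y].
- by J_check; ring.
- by rewrite /nijenhuis; J_check; ring.
rewrite !metS; J_simpl; congr (_ + _); first by ring.
apply: eq_big_nat => l /sum_range lP; J_simpl; ring.
Qed.

(** The right-hand side is the 3-form f^1 f^2 f^3. *)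
Lemma bismut_standard x y z : bismut J met x y z =
  c 1 x * (c 2 y * c 3 z - c 3 y * c 2 z)
  - c 1 y * (c 2 x * c 3 z - c 3 x * c 2 z)
  + c 1 z * (c 2 x * c 3 y - c 3 x * c 2 y).
Proof.
rewrite /bismut !metS; J_simpl.
set S1 := \sum_(_ <= _ < _) _; set S2 := \sum_(_ <= _ < _) _.
set S3 := \sum_(_ <= _ < _) _.
(* On each block the composite of the rotation generator and [J] is symmetric, so the contributions
   cancel in pairs. *)
have S0 : S1 - S2 + S3 = 0.
  rewrite -sumrB -big_split /= big1_seq // => l /andP[_].
  rewrite mem_index_iota => /sum_range lP; J_simpl; ring.
have -> : S1 = S2 - S3 by move: S0; lra.
ring.
Qed.

Lemma standard_skt : skt J met.
Proof.
move=> X; rewrite (ced_dc_fund_form standard_hermitian) !bismut_standard.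
by J_simpl; rewrite (_ : _ + _ = 0) //; ring.
Qed.

Lemma mem_k2_standard N : (forall x, (x \in N) = (t x == 0)) ->
  forall x, (x \in k2 met N) = (c 1 x == 0) && (t x == 0).
Proof.
move=> NE x; rewrite memv_cap NE (lcs1_adapted NE) mem_orthov_line; congr (_ && _).
rewrite metS !coordsE big1_seq => [|l /andP[_]].
  by rewrite !mulr0 mulr1 !addr0.
by rewrite mem_index_iota => /sum_range lP; rewrite !coordsE // !mulr0 addr0.
Qed.

Lemma mem_k3_standard N : (forall x, (x \in N) = (t x == 0)) ->
  forall x, x \in k3 J met N -> [/\ c 1 x = 0, c 2 x = 0, c 3 x = 0 & t x = 0].
Proof.
move=> NE x; rewrite memv_cap mem_k2_standard // => /andP[/andP[/eqP x1 /eqP xt]].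
move=> /memv_imgP[y]; rewrite mem_k2_standard // => /andP[/eqP y1 /eqP yt] xE.
by rewrite x1 xt xE; J_simpl; rewrite y1 yt oppr0.
Qed.

Lemma standard_special_skt N : almost_nilpotent N -> special_skt J met N.
Proof.
move=> /adapted_nilradical NE.
have k3P x : c 1 x = 0 -> c 2 x = 0 -> c 3 x = 0 -> t x = 0 -> x \in k3 J met N.
  move=> x1 x2 x3 xt; rewrite memv_cap mem_k2_standard // x1 xt eqxx /=.
  apply/memv_imgP; exists (- J x); last first.
    by case: standard_hermitian => JJ _ _; rewrite linearN /= JJ opprK.
  by rewrite mem_k2_standard //; J_simpl; rewrite x2 x3 oppr0 eqxx.
split.
- exact: standard_hermitian.
- exact: standard_skt.
- rewrite (lcs1_adapted NE) limg_line -memvE NE; J_simpl.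
- apply/is_idealP => x y /(mem_k3_standard NE)[y1 y2 y3 yt].
  by apply: k3P; J_simpl; rewrite ?y1 ?y2 ?y3 ?yt; ring.
- apply/is_abelianP => x y.
  move=> /(mem_k3_standard NE)[x1 x2 x3 xt] /(mem_k3_standard NE)[y1 y2 y3 yt].
  by J_check; rewrite ?x1 ?x2 ?x3 ?xt ?y1 ?y2 ?y3 ?yt; ring.
Qed.

Lemma standard_J_vec : standard_J f J.
Proof.
split=> [||l lP].
- by rewrite (vec1E f_basis n_ge2) (vec2E f_basis n_ge2); J_check; ring.
- by rewrite (vec3E f_basis n_ge2) (vectE f_basis n_ge2); J_check; ring.
by rewrite (veceE f_basis n_ge2) // (vecoE f_basis n_ge2) //; J_check; ring.
Qed.

End Standard.

End Adapted.

(** * From the brackets of basis vectors to the structure equations *)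

Section FromBrackets.
Variables (R : realType) (n : nat) (g : lieAlgType R) (f : (2 * n).-tuple g).
Variable b : nat -> R.
Hypothesis f_basis : basis_of fullv f.
Hypothesis n_ge2 : (2 <= n)%N.
Implicit Types x y : g.

Notation c := (cov f).
Notation v := (vec f).
Notation t := (cov f (2 * n)).
Notation coords := (coords f).
Notation z_ := (fun _ : nat => 0 : R).
Let coordsE := (cov1_coords f_basis n_ge2, cov2_coords f_basis n_ge2,
  cov3_coords f_basis n_ge2, covt_coords f_basis n_ge2,
  cove_coords f_basis n_ge2, covo_coords f_basis n_ge2).

Hypothesis v1_central : forall y, t y = 0 -> lieb (v 1) y = 0.
Hypothesis vl_central : forall l, (1 <= l <= n - 2)%N -> forall y, t y = 0 ->
  lieb (v (2 * l + 2)) y = 0 /\ lieb (v (2 * l + 3)) y = 0.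
Hypothesis v23 : lieb (v 2) (v 3) = - v 1.
Hypothesis vt1 : lieb (v (2 * n)) (v 1) = 0.
Hypothesis vt2 : lieb (v (2 * n)) (v 2) = - v 2.
Hypothesis vt3 : lieb (v (2 * n)) (v 3) = v 3.
Hypothesis vtl : forall l, (1 <= l <= n - 2)%N ->
  lieb (v (2 * n)) (v (2 * l + 2)) = - b l *: v (2 * l + 3) /\
  lieb (v (2 * n)) (v (2 * l + 3)) = b l *: v (2 * l + 2).

Ltac cov_check := apply: (adapted_eq f_basis n_ge2); [| | | |
  let j := fresh "j" in let jP := fresh "jP" in move=> j jP; split];
  rewrite ?(covE, coordsE) //.

Let D x := coords 0 (- c 2 x) (c 3 x) 0 (fun l => b l * c (2 * l + 3) x)
  (fun l => - b l * c (2 * l + 2) x).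

Let D_lin : linear D.
Proof. by move=> a x y; cov_check; ring. Qed.

Let lieb_t x : lieb (v (2 * n)) x = D x.
Proof.
have [F FE] := linear_lfun D_lin.
rewrite -FE -adE (cov_expand f_basis x) !linear_sum.
apply: eq_big_nat => k kP; rewrite !linearZ /= FE adE; congr (_ *: _).
move: k kP; apply: (adapted_index_ind n_ge2) => [||||l lP].
- by rewrite vt1 (vec1E f_basis n_ge2); cov_check; rewrite ?cov0; ring.
- by rewrite vt2 (vec2E f_basis n_ge2); cov_check; ring.
- by rewrite vt3 (vec3E f_basis n_ge2); cov_check; ring.
- by rewrite liebxx (vectE f_basis n_ge2); cov_check; rewrite ?cov0; ring.
have [-> ->] := vtl lP.
rewrite (veceE f_basis n_ge2 lP) (vecoE f_basis n_ge2 lP).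
split; cov_check; try ring.
all: by have [->|_] := eqVneq j l; rewrite ?mulr1n ?mulr0n; ring.
Qed.

(** Inside the kernel of f^{2n} only f_2 and f_3 have a nonzero bracket; [z] collects the components
    that centralise this hyperplane. *)
Let nil_part x : t x = 0 -> exists2 z,
  x = c 2 x *: v 2 + c 3 x *: v 3 + z & t z = 0 /\ forall y, t y = 0 -> lieb z y = 0.
Proof.
move=> tx; pose z := x - c 2 x *: v 2 - c 3 x *: v 3; exists z.
  by rewrite /z -[x - _ - _]addrA -opprD [RHS]addrC subrK.
have cz : c 2 z = 0 /\ c 3 z = 0 /\ t z = 0.
  rewrite /z (vec2E f_basis n_ge2) (vec3E f_basis n_ge2) !covE !coordsE tx.
  by do !split; ring.
split=> [|y ty]; first by case: cz => _ [].
rewrite liebC (cov_expand f_basis z) lieb_sumr big1_seq ?oppr0 // => k /andP[_].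
rewrite mem_index_iota ltnS => kP; rewrite liebZr liebC.
case: cz => z2 [z3 zt].
move: k kP; apply: (adapted_index_ind n_ge2) => [||||l lP].
- by rewrite v1_central // oppr0 scaler0.
- by rewrite z2 scale0r.
- by rewrite z3 scale0r.
- by rewrite zt scale0r.
by have [-> ->] := vl_central lP ty; rewrite oppr0 !scaler0.
Qed.

Let lieb_nil x y : t x = 0 -> t y = 0 ->
  lieb x y = (c 3 x * c 2 y - c 2 x * c 3 y) *: v 1.
Proof.
move=> tx ty; have [z xE [tz zc]] := nil_part tx.
have [z' yE [tz' zc']] := nil_part ty.
have t2 : t (v 2) = 0 by rewrite (vec2E f_basis n_ge2) coordsE.
have t3 : t (v 3) = 0 by rewrite (vec3E f_basis n_ge2) coordsE.
have v32 : lieb (v 3) (v 2) = v 1 by rewrite liebC v23 opprK.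
rewrite {1}xE liebDl zc // addr0 {1}yE.
have z2 u : t u = 0 -> lieb u z' = 0 by move=> tu; rewrite liebC zc' ?oppr0.
rewrite liebDr z2 ?addr0; last by rewrite !covE t2 t3 !mulr0 addr0.
rewrite !(liebDl, liebDr, liebZl, liebZr) !liebxx v23 v32 !scaler0.
rewrite addr0 add0r !scalerN !scalerA -scaleNr -scalerDl; congr (_ *: _).
by ring.
Qed.

(** The algebra is the extension of the kernel of f^{2n} by the derivation [D], which is ad
    f_{2n}. *)
Let lieb_split x y : lieb x y = (c 3 x * c 2 y - c 2 x * c 3 y) *: v 1
  + t x *: D y - t y *: D x.
Proof.
have dec u : exists2 u', u = u' + t u *: v (2 * n) &
    [/\ t u' = 0, c 2 u' = c 2 u, c 3 u' = c 3 u & D u' = D u].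
  exists (u - t u *: v (2 * n)); first by rewrite subrK.
  rewrite (vectE f_basis n_ge2); split; rewrite ?covE ?coordsE; try ring.
  by cov_check; ring.
have [x' xE [tx <- <- <-]] := dec x; have [y' yE [ty <- <- <-]] := dec y.
rewrite {1}xE {1}yE !(liebDl, liebDr) lieb_nil //.
rewrite !(liebZl, liebZr) liebxx !scaler0 addr0.
by rewrite lieb_t [lieb x' _]liebC lieb_t scalerN addrAC.
Qed.

Lemma adapted_of_brackets : adapted_basis f b.
Proof.
have imax : i1 0 = ord_max by apply: val_inj.
have r1 := vec1E f_basis n_ge2.
split=> //; first split=> X; last move=> l lP; last split=> X.
all: rewrite ced_form1 imax lieb_split r1 !covE ?coordsE // ?coordsE //.
all: rewrite -?[(- wedge _ _) X]/(- wedge _ _ X) /wedge.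
all: try ring.
Qed.

End FromBrackets.

(** * Traces on quotients and skew endomorphisms *)

(* The trace on a quotient computed from any family spanning it, with the
   coefficients of some (not necessarily unique) decomposition. *)
Lemma quo_traceE (K : fieldType) (g : lieAlgType K) (d : g)
    (U W : {vspace g}) (I : eqType) (r : seq I) (z : I -> g) (phi : I -> g -> K) :
    (W <= U)%VS -> {in U, forall y, lieb d y \in U} ->
    {in W, forall y, lieb d y \in W} ->
    (forall i, scalar (phi i)) -> {in r, forall i, z i \in U} ->
    {in r, forall i, {in W, forall y, phi i y = 0}} ->
    {in U, forall y, y - \sum_(i <- r) phi i y *: z i \in W} ->
  quo_trace (lieb d) U W = \sum_(i <- r) phi i (lieb d (z i)).
Proof.
move=> /subvP sWU fU fW phi_lin zU phiW zW; rewrite /quo_trace.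
set X := vbasis _.
have phi0 i : phi i 0 = 0.
  by have := phi_lin i (- 1) 0 0; rewrite scaler0 add0r mulN1r addNr.
have phiD i x y : phi i (x + y) = phi i x + phi i y.
  by have := phi_lin i 1 x y; rewrite scale1r mul1r.
have phiZ i a x : phi i (a *: x) = a * phi i x.
  by have := phi_lin i a x 0; rewrite phi0 !addr0.
have phi_sum i (J : Type) (s : seq J) F :
    phi i (\sum_(j <- s) F j) = \sum_(j <- s) phi i (F j).
  exact: (big_morph _ (phiD i) (phi0 i)).
pose psi j x := coord X j (addv_pi1 U W x).
have psiE j x : psi j x = coord X j (addv_pi1 U W x) by [].
have psiW j x : x \in W -> psi j x = 0.
  move=> xW; have := addv_pi1_pi2 (subvP (addvSr U W) _ xW).
  rewrite addv_pi2_id // => /(canRL (addrK _)); rewrite subrr psiE => ->.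
  by rewrite linear0.
have dec x : x \in U -> exists2 w, w \in W & x = \sum_j psi j x *: X`_j + w.
  move=> xU; exists (addv_pi2 U W x); first exact: memv_pi2.
  rewrite -[LHS](addv_pi1_pi2 (subvP (addvSl U W) _ xU)); congr (_ + _).
  exact: (coord_vbasis (memv_pi (U :\: W) W x)).
have XU (j : 'I_(\dim (U :\: W))) : X`_j \in U.
  by apply: (subvP (diffvSl U W)); apply: vbasis_mem; rewrite mem_nth ?size_tuple.
(* This is tr(PQ) = tr(QP): expand [lieb d X_j] along the family [z], exchange the sums, then
   recombine each [z i] from its coordinates in [X] modulo [W]. *)
transitivity (\sum_j psi j (\sum_(i <- r) phi i (lieb d X`_j) *: z i)).
  apply: eq_bigr => j _; rewrite -psiE.
  have := zW _ (fU _ (XU j)); set s := \sum_(i <- r) _ => /(psiW j)/eqP.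
  by rewrite psiE !linearB /= subr_eq0 => /eqP.
under eq_bigr do rewrite psiE !linear_sum /=.
rewrite exchange_big /=; apply: eq_big_seq => i ir.
have [w wW zE] := dec _ (zU i ir).
rewrite {2}zE liebDr phiD (phiW _ ir _ (fW _ wW)) addr0 lieb_sumr phi_sum.
by apply: eq_bigr => j _; rewrite !linearZ /= liebZr phiZ mulrC.
Qed.

(** * Orthonormal bases, symmetric and skew endomorphisms *)

Section DotSpectral.
Variables (R : realType) (V : vectType R) (met : {dot V for idfun}).
Implicit Types (x y u w : V) (W : {vspace V}).

(* A real eigenvector is the real or imaginary part of a complex one. *)
Lemma symmetric_eigenvector (S : 'End(V)) W :
    {in W, forall x, S x \in W} ->
    {in W &, forall x y, met (S x) y = met x (S y)} -> W != 0%VS ->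
  exists x a, [/\ x \in W, x != 0 & S x = a *: x].
Proof.
move=> SW S_sym W0; set e := vbasis W.
pose M := \matrix_(i < \dim W, j < \dim W) coord e j (S e`_i).
have W_gt0 : (0 < \dim W)%N by rewrite lt0n dimv_eq0.
have [a] := eigenvalue_closed (map_mx (real_complex R) M) W_gt0.
case/eigenvalueP => u uM u0.
pose p j := complex.Re (u 0 j); pose q j := complex.Im (u 0 j).
pose x := \sum_j p j *: e`_j; pose y := \sum_j q j *: e`_j.
have eW (j : 'I_(\dim W)) : e`_j \in W by rewrite vbasis_mem ?mem_nth ?size_tuple.
have xW : x \in W by apply: memv_suml => j _; apply: memvZ.
have yW : y \in W by apply: memv_suml => j _; apply: memvZ.
have S_lin (h : 'I_(\dim W) -> R) :
    S (\sum_j h j *: e`_j) = \sum_k (\sum_j h j * M j k) *: e`_k.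
  rewrite linear_sum; under [RHS]eq_bigr do rewrite scaler_suml.
  rewrite exchange_big; apply: eq_bigr => j _ /=; rewrite linearZ /=.
  rewrite {1}(coord_vbasis (SW _ (eW j))) scaler_sumr.
  by apply: eq_bigr => k _; rewrite scalerA mxE.
have uMk k : \sum_j u 0 j * (M j k)%:C%C = a * u 0 k.
  move/rowP/(_ k): uM; rewrite !mxE => <-.
  by apply: eq_bigr => j _; rewrite !mxE.
have re k : \sum_j p j * M j k = complex.Re a * p k - complex.Im a * q k.
  have := congr1 (@complex.Re R) (uMk k); rewrite raddf_sum /=.
  rewrite /p /q; case: (a) => ar ai; case: (u 0 k) => ur ui /= <-.
  by apply: eq_bigr => j _; case: (u 0 j) => ? ? /=; rewrite mulr0 subr0.
have im k : \sum_j q j * M j k = complex.Im a * p k + complex.Re a * q k.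
  have := congr1 (@complex.Im R) (uMk k); rewrite raddf_sum /=.
  rewrite /p /q; case: (a) => ar ai; case: (u 0 k) => ur ui /= h.
  rewrite addrC -h.
  by apply: eq_bigr => j _; case: (u 0 j) => ? ? /=; rewrite mulr0 add0r.
have Sx : S x = complex.Re a *: x - complex.Im a *: y.
  rewrite S_lin !scaler_sumr -sumrB; apply: eq_bigr => k _.
  by rewrite re scalerBl !scalerA.
have Sy : S y = complex.Im a *: x + complex.Re a *: y.
  rewrite S_lin !scaler_sumr -big_split; apply: eq_bigr => k _ /=.
  by rewrite im scalerDl !scalerA.
have /freeP e_free : free e := basis_free (vbasisP W).
have xy0 : ~~ ((x == 0) && (y == 0)).
  apply: contra u0 => /andP[/eqP/e_free x0 /eqP/e_free y0].
  apply/eqP/rowP => j; rewrite mxE; have := x0 j; have := y0 j.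
  by rewrite /p /q; case: (u 0 j) => ? ? /= -> ->.
(* Symmetry of [S] on the real part [x] and the imaginary part [y] gives Im(a) (|x|^2 + |y|^2) =
   0. *)
have ima : complex.Im a = 0.
  have := S_sym _ _ xW yW; rewrite Sx Sy !dotE => h.
  have /eqP : complex.Im a * (met x x + met y y) = 0 by lra.
  rewrite mulf_eq0 => /orP[/eqP //|]; rewrite paddr_eq0 ?dot_ge0 //.
  by rewrite !dot_eq0 (negPf xy0).
move: xy0; rewrite negb_and => /orP[x0|y0].
  by exists x, (complex.Re a); rewrite Sx ima scale0r subr0.
by exists y, (complex.Re a); rewrite Sy ima scale0r add0r.
Qed.

Lemma exists_unit W : W != 0%VS -> exists2 e, e \in W & met e e = 1.
Proof.
rewrite -vpick0; set x := vpick W => x0.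
have mx : 0 < met x x by rewrite dot_gt0.
exists ((Num.sqrt (met x x))^-1 *: x); first by rewrite memvZ ?memv_pick.
by rewrite dotZl dotZr mulrA -invfM -expr2 sqr_sqrtr ?ltW // mulVf ?gt_eqF.
Qed.

(** An orthonormal basis, recorded through its expansion formula; it is built by splitting off a
    unit vector and passing to the orthogonal complement. *)
Lemma exists_frame W : exists2 s : seq V, {subset s <= W} &
  {in W, forall x, x = \sum_(u <- s) met x u *: u}.
Proof.
have [m] := ubnP (\dim W); elim: m W => // m IHm W; rewrite ltnS => dimW.
have [->|W0] := eqVneq W 0%VS.
  by exists [::] => // x; rewrite memv0 big_nil => /eqP.
have [e eW e1] := exists_unit W0.
have e0 : e != 0 by rewrite -(dot_eq0 met) e1 oner_eq0.
have [] := IHm (W :&: orthov met <[e]>)%VS.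
  by rewrite dim_cap_orthov1.
move=> s sW' sE; have oe u : u \in s -> met u e = 0.
  by move/sW'; rewrite memv_cap mem_orthov_line => /andP[_ /eqP].
exists (e :: s) => [u|x xW].
  by rewrite inE => /predU1P[-> //|/sW']; rewrite memv_cap => /andP[].
rewrite big_cons; apply/eqP; rewrite addrC -subr_eq; apply/eqP.
rewrite [LHS]sE.
  apply: eq_big_seq => u us.
  by rewrite dotDl dotNl dotZl (dotC met e) (oe u) // mulr0 subr0.
rewrite memv_cap mem_orthov_line rpredB ?rpredZ //=.
by rewrite dotDl dotNl dotZl e1 mulr1 subrr.
Qed.

(* With a_(u,w) = met (A u) w the hypothesis on s says that the sum of all
   (a_(u,w) + a_(w,u))^2 is zero. *)
Lemma skew_of_frame (A : 'End(V)) W (s : seq V) :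
    {in W, forall x, A x \in W} -> {subset s <= W} ->
    {in W, forall x, x = \sum_(u <- s) met x u *: u} ->
    \sum_(u <- s) (met (A u) (A u) + met (A (A u)) u) = 0 ->
  {in W &, forall x y, met (A x) y = - met x (A y)}.
Proof.
move=> AW sW sE sum0.
pose a u w := met (A u) w.
have normA x y : x \in W -> met x y = \sum_(w <- s) met x w * met w y.
  move=> xW; rewrite {1}(sE _ xW) dot_suml.
  by apply: eq_bigr => w _; rewrite dotZl.
have key u : u \in s -> \sum_(w <- s) (a u w ^+ 2 + a u w * a w u)
    = met (A u) (A u) + met (A (A u)) u.
  move=> us; have AuW := AW _ (sW _ us).
  rewrite (normA (A u) (A u)) // {3}(sE _ AuW) linear_sum dot_suml -big_split.
  by apply: eq_bigr => w _ /=; rewrite linearZ /= dotZl /a (dotC met w) expr2.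
have sumE : \sum_(u <- s) \sum_(w <- s) (a u w + a w u) ^+ 2 = 0.
  pose T := \sum_(u <- s) \sum_(w <- s) (a u w ^+ 2 + a u w * a w u).
  have T0 : T = 0 by rewrite -sum0; apply: eq_big_seq.
  have TE : T = \sum_(u <- s) \sum_(w <- s) (a w u ^+ 2 + a w u * a u w).
    exact: exchange_big.
  (* Adding to [T] its copy with [u] and [w] exchanged completes the squares. *)
  transitivity (T + T); last by rewrite T0 addr0.
  rewrite {2}TE -big_split /=; apply: eq_bigr => u _.
  by rewrite -big_split; apply: eq_bigr => w _ /=; ring.
have a0 : {in s &, forall u w, a u w + a w u = 0}.
  move=> u w us ws; move/eqP: sumE.
  rewrite psumr_eq0 => [|? _]; last by apply: sumr_ge0 => ? _; apply: sqr_ge0.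
  move/allP/(_ u us); rewrite /= psumr_eq0 => [|? _]; last exact: sqr_ge0.
  by move/allP/(_ w ws); rewrite /= sqrf_eq0 => /eqP.
move=> x y xW yW; apply/eqP; rewrite -addr_eq0.
have -> : met (A x) y = \sum_(u <- s) \sum_(w <- s) met x u * met y w * a u w.
  rewrite {1}(sE _ xW) linear_sum dot_suml; apply: eq_bigr => u _.
  rewrite linearZ /= {1}(sE _ yW) dot_sumr; apply: eq_bigr => w _.
  by rewrite dotZl dotZr mulrA.
have -> : met x (A y) = \sum_(u <- s) \sum_(w <- s) met x u * met y w * a w u.
  rewrite {1}(sE _ xW) dot_suml; apply: eq_bigr => u _.
  rewrite {1}(sE _ yW) linear_sum dot_sumr; apply: eq_bigr => w _.
  by rewrite linearZ /= dotZl dotZr mulrA (dotC met u).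
apply/eqP; rewrite -big_split big1_seq // => u /andP[_ us].
rewrite -big_split big1_seq // => w /andP[_ ws] /=.
by rewrite -mulrDr a0 // mulr0.
Qed.

(* An eigenvector x of the symmetric map A J spans with J x a plane on which
   A is a rotation generator. *)
Lemma skew_normal_form (J A : 'End(V)) W :
    (forall x, J (J x) = - x) -> (forall x y, met (J x) (J y) = met x y) ->
    {in W, forall x, J x \in W} -> {in W, forall x, A x \in W} ->
    {in W, forall x, A (J x) = J (A x)} ->
    {in W &, forall x y, met (A x) y = - met x (A y)} ->
  exists (s : seq V) (b : nat -> R), [/\ (W <= <<s>>)%VS, {subset s <= W},
    size s = \dim W &
    forall l, ((2 * l).+1 < size s)%N -> A s`_(2 * l) = - b l *: s`_(2 * l).+1 /\
      A s`_(2 * l).+1 = b l *: s`_(2 * l)].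
Proof.
move=> JJ metJ.
have metJl x y : met (J x) y = - met x (J y) by rewrite -metJ JJ dotNl.
have metJx x : met x (J x) = 0 by have := metJl x x; rewrite (dotC met (J x)); lra.
have [m] := ubnP (\dim W); elim: m W => // m IHm W; rewrite ltnS => dimW.
move=> JW AW AJ A_skew; have [W0|W0] := eqVneq W 0%VS.
  exists [::], (fun _ => 0); rewrite W0 dimv0; split=> //.
  exact: sub0v.
(* On [W] the commuting maps A and J are both skew, so that their composite is symmetric. *)
have [||x [lam [xW x0 xE]]] := @symmetric_eigenvector (A \o J)%VF W _ _ W0.
- by move=> y yW; rewrite comp_lfunE AW ?JW.
- move=> y z yW zW; rewrite !comp_lfunE A_skew ?JW // metJl opprK.
  by rewrite AJ.
rewrite comp_lfunE in xE.
have Ax : A x = - lam *: J x.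
  by rewrite scaleNr -linearZ /= -xE -AJ ?JW // JJ linearN opprK.
have JxW := JW _ xW.
have Jx0 : J x != 0 by apply: contraNneq x0 => Jx; rewrite -oppr_eq0 -JJ Jx linear0.
pose W1 := (W :&: orthov met <[x]>)%VS.
(* The plane of [x] and [J x] is stable under the skew maps [A] and [J], hence so is its orthogonal
   complement [W2] in [W]. *)
pose W2 := (W1 :&: orthov met <[J x]>)%VS.
have W2P y : y \in W2 = [&& y \in W, met y x == 0 & met y (J x) == 0].
  by rewrite !memv_cap !mem_orthov_line andbA.
have JxW1 : J x \in W1 by rewrite memv_cap JxW mem_orthov_line metJl metJx oppr0 /=.
have dimW2 : (\dim W2).+2 = \dim W by rewrite !dim_cap_orthov1.
have [|y|y|y|y z|s [b [sW2 sub_s size_s sA]]] := IHm W2.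
- by move: dimW; rewrite -dimW2 => /ltnW.
- rewrite !W2P => /and3P[yW /eqP yx /eqP yJx].
  by rewrite JW // metJl yJx metJ yx oppr0 eqxx.
- rewrite !W2P => /and3P[yW /eqP yx /eqP yJx].
  by rewrite AW //= !A_skew // Ax xE !dotZr yx yJx !mulr0 oppr0 eqxx.
- by rewrite W2P => /andP[yW _]; apply: AJ.
- by rewrite !W2P => /andP[yW _] /andP[zW _]; apply: A_skew.
(* The new plane comes first with parameter [lam], so the parameters found on [W2] shift by one. *)
exists [:: x, J x & s], (fun l => if l is l'.+1 then b l' else lam); split.
- apply/subvP => y yW; rewrite !span_cons.
  set u := met y x / met x x *: x; set w := met y (J x) / met x x *: J x.
  have -> : y = u + (w + (y - u - w)).
    by rewrite [w + _]addrC subrK addrC subrK.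
  rewrite memv_add ?memvZ ?memv_line // memv_add ?memvZ ?memv_line //.
  apply: (subvP sW2); rewrite W2P !rpredB ?rpredZ //=.
  have mx := dot_neq0 met x0.
  rewrite !(dotDl, dotNl, dotZl) metJ (metJl x x) metJx.
  by rewrite !divfK // oppr0 !mulr0 !subr0 !subrr eqxx.
- move=> y; rewrite !inE => /or3P[/eqP ->|/eqP ->|/sub_s] //.
  by rewrite W2P => /andP[].
- by rewrite /= size_s.
move=> [|l]; first by rewrite /= Ax xE.
have -> : (2 * l.+1 = (2 * l).+2)%N by lia.
by rewrite /= !ltnS; apply: sA.
Qed.

End DotSpectral.

(** * From SKT structures to adapted bases *)

Lemma lieS_ideal (K : fieldType) (g : lieAlgType K) (U W : {vspace g}) :
  is_ideal U -> is_ideal W -> is_ideal (lieS U W).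
Proof.
move=> /is_idealP idU /is_idealP idW; apply/is_idealP => x y yUW.
rewrite -adE memv_preim; apply: subvP y yUW; apply/lieS_subP => u w uU wW.
rewrite -memv_preim adE lieb_derivation rpredD ?lieb_lieS //.
- exact: idU.
- exact: idW.
Qed.

(** Subtracting from a vector outside [N] its projection to [N] gives a normal direction; [N] is its
    orthogonal complement by dimension. *)
Lemma unit_normal (R : realType) (V : vectType R) (met : {dot V for idfun})
    (N : {vspace V}) : (\dim N).+1 = \dim {:V} ->
  exists2 e, met e e = 1 & forall x, (x \in N) = (met x e == 0).
Proof.
move=> dimN; have [s sN sE] := exists_frame met N.
have /subvPn[x _ xN] : ~~ (fullv <= N)%VS.
  by apply/negP => /dimvS; rewrite -dimN ltnn.
pose d := x - \sum_(u <- s) met x u *: u.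
have dN y : y \in N -> met d y = 0.
  move=> yN; rewrite dotDl dotNl dot_suml {1}(sE _ yN) dot_sumr.
  apply/eqP; rewrite subr_eq0; apply/eqP; apply: eq_bigr => u _.
  by rewrite dotZl dotZr mulrC (dotC met u).
have d0 : <[d]>%VS != 0%VS.
  apply: contraNneq xN => /eqP; rewrite -subv0 -memvE memv0 subr_eq0 => /eqP ->.
  by rewrite big_seq; apply: memv_suml => u us; apply: memvZ; apply: sN.
have [e /vlineP[k eE] e1] := exists_unit met d0.
have e0 : e != 0 by rewrite -(dot_eq0 met) e1 oner_eq0.
exists e => // y.
suff -> : N = orthov met <[e]> by rewrite mem_orthov_line.
apply/eqP; rewrite eqEdim; apply/andP; split.
  by apply/subvP => z zN; rewrite mem_orthov_line eE dotC dotZl dN // mulr0.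
have := dim_cap_orthov1 met (memvf e) e0.
by rewrite capfv -dimN => -[->].
Qed.

Section SpecialSKT.
Variables (R : realType) (n : nat) (g : lieAlgType R) (N : {vspace g}).
Hypothesis n_ge2 : (2 <= n)%N.
Hypothesis dim_g : \dim {:g} = (2 * n)%N.
Hypothesis an_g : almost_nilpotent N.
Hypothesis su_g : strongly_unimodular N.
Hypothesis dim_N1 : \dim (lcs N 1) = 1%N.
Variables (J : 'End(g)) (met : {dot g for idfun}).
Hypothesis J_skt : special_skt J met N.
Implicit Types x y z u w : g.

Let herm : hermitian_structure J met. Proof. by case: J_skt. Qed.
Let JJ := JJ herm.
Let dotJJ := dotJJ herm.
Let dotJl := dotJl herm.

Let N_ideal : is_ideal N. Proof. by case: an_g => _ []. Qed.

Let N_lieb x y : y \in N -> lieb x y \in N.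
Proof. by move: x y; apply/is_idealP. Qed.

Variables e1 e2 e3 et : g.
Hypothesis e1_unit : met e1 e1 = 1.
Hypothesis e1_N1 : lcs N 1 = <[e1]>%VS.
Hypothesis et_unit : met et et = 1.
Hypothesis etN : forall x, (x \in N) = (met x et == 0).

Hypothesis e2E : J e1 = e2.
Hypothesis e3E : J et = - e3.
Let W := k3 J met N.

Let e1N : e1 \in N.
Proof.
have /subvP : (lcs N 1 <= N)%VS by apply/lieS_subP => u w _; apply: N_lieb.
by apply; rewrite e1_N1 memv_line.
Qed.

Let e2N : e2 \in N.
Proof.
case: J_skt => _ _ /subvP JN1 _ _; apply: JN1.
by rewrite -e2E memv_img // e1_N1 memv_line.
Qed.

Let Je2 : J e2 = - e1. Proof. by rewrite -e2E JJ. Qed.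
Let Je3 : J e3 = et.
Proof. by rewrite -[e3]opprK -e3E linearN /= JJ opprK. Qed.

Let m22 : met e2 e2 = 1. Proof. by rewrite -e2E dotJJ. Qed.
Let m33 : met e3 e3 = 1. Proof. by rewrite -dotJJ Je3. Qed.
Let m1t : met e1 et = 0. Proof. by apply/eqP; rewrite -etN. Qed.
Let m2t : met e2 et = 0. Proof. by apply/eqP; rewrite -etN. Qed.
Let m3t : met e3 et = 0. Proof. by rewrite -Je3 dotC (dotJxx herm). Qed.
Let m21 : met e2 e1 = 0. Proof. by rewrite -e2E (dotJxx herm). Qed.
Let m12 : met e1 e2 = 0. Proof. by rewrite dotC. Qed.
Let m13 : met e1 e3 = 0. Proof. by rewrite -dotJJ e2E Je3. Qed.
Let m31 : met e3 e1 = 0. Proof. by rewrite dotC. Qed.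
Let m23 : met e2 e3 = 0.
Proof. by rewrite -dotJJ Je2 Je3 dotNl m1t oppr0. Qed.
Let m32 : met e3 e2 = 0. Proof. by rewrite dotC. Qed.
Let mt1 : met et e1 = 0. Proof. by rewrite dotC. Qed.
Let mt2 : met et e2 = 0. Proof. by rewrite dotC. Qed.
Let mt3 : met et e3 = 0. Proof. by rewrite dotC. Qed.
Let mE := (e1_unit, et_unit, m22, m33, m1t, m2t, m3t, m21, m12, m13, m31, m23,
  m32, mt1, mt2, mt3).

Let e3N : e3 \in N. Proof. by rewrite etN m3t. Qed.

Let mem_k2 x : (x \in k2 met N) = (met x e1 == 0) && (met x et == 0).
Proof. by rewrite memv_cap e1_N1 mem_orthov_line etN. Qed.

(** k2 is the orthogonal complement of [e1] and [et], so J k2 is that of J e1 = e2 and J et = -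
    e3. *)
Let mem_W x : (x \in W) =
  [&& met x e1 == 0, met x e2 == 0, met x e3 == 0 & met x et == 0].
Proof.
rewrite memv_cap mem_k2.
have -> : (x \in J @: k2 met N)%VS = (met x e2 == 0) && (met x e3 == 0).
  apply/memv_imgP/andP => [[y + ->]|[/eqP x2 /eqP x3]].
    by rewrite mem_k2 -{1}e2E -[e3]opprK -e3E dotJJ dotNr dotJJ oppr_eq0 => /andP[].
  exists (- J x); last by rewrite linearN /= JJ opprK.
  by rewrite mem_k2 !dotNl !dotJl !opprK e2E e3E dotNr x2 x3 oppr0 eqxx.
by case: (met x e1 == 0); case: (met x et == 0); rewrite /= ?andbT ?andbF.
Qed.

Let W_N x : x \in W -> x \in N.
Proof. by rewrite mem_W etN => /and4P[]. Qed.

Let W_J x : x \in W -> J x \in W.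
Proof.
rewrite !mem_W => /and4P[/eqP x1 /eqP x2 /eqP x3 /eqP xt].
by rewrite !dotJl e2E Je2 Je3 e3E !dotNr x1 x2 x3 xt !oppr0 eqxx.
Qed.

Let W_lieb x w : w \in W -> lieb x w \in W.
Proof. by case: J_skt => _ _ _ /is_idealP h _; apply: h. Qed.

Let W_orth w : w \in W ->
  [/\ met w e1 = 0, met w e2 = 0, met w e3 = 0 & met w et = 0].
Proof. by rewrite mem_W => /and4P[/eqP ? /eqP ? /eqP ? /eqP ?]. Qed.

Let dim_W : \dim W = (2 * n - 4)%N.
Proof.
have nz e : met e e = 1 -> e != 0.
  by move=> ee; rewrite -(dot_eq0 met) ee oner_eq0.
pose U1 := (fullv :&: orthov met <[e1]>)%VS.
pose U2 := (U1 :&: orthov met <[e2]>)%VS.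
pose U3 := (U2 :&: orthov met <[e3]>)%VS.
have -> : W = (U3 :&: orthov met <[et]>)%VS.
  by apply/vspaceP => x; rewrite mem_W !memv_cap !mem_orthov_line memvf -!andbA.
have h : (\dim (U3 :&: orthov met <[et]>)%VS).+4 = \dim {:g}.
  rewrite !dim_cap_orthov1 ?nz ?memvf ?mE //.
  - by rewrite !memv_cap !mem_orthov_line memvf !mE eqxx.
  - by rewrite !memv_cap !mem_orthov_line memvf !mE eqxx.
  - by rewrite !memv_cap !mem_orthov_line memvf !mE eqxx.
by rewrite -dim_g -h -addn4 addnK.
Qed.

Let N_split x : x \in N -> exists2 w, w \in W &
  x = met x e1 *: e1 + met x e2 *: e2 + met x e3 *: e3 + w.
Proof.
rewrite etN => /eqP xt.
exists (x - (met x e1 *: e1 + met x e2 *: e2 + met x e3 *: e3)).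
  rewrite mem_W !(dotDl, dotNl, dotZl) !mE xt.
  by rewrite !(mulr0, mulr1, add0r, addr0) !subrr oppr0 eqxx.
by rewrite addrC subrK.
Qed.

Let N_split_t x : exists2 y, y \in N & x = y + met x et *: et.
Proof.
exists (x - met x et *: et); last by rewrite subrK.
by rewrite etN dotDl dotNl dotZl et_unit mulr1 subrr.
Qed.

(** * Brackets inside the nilradical *)

Let liebNN x y : x \in N -> y \in N -> lieb x y = met (lieb x y) e1 *: e1.
Proof.
move=> xN yN; have : lieb x y \in <[e1]>%VS by rewrite -e1_N1 lieb_lieS.
by move=> /vlineP[k ->]; rewrite dotZl e1_unit mulr1.
Qed.

(** The bracket is a multiple of [e1], but it also lies in the ideal [W], which is orthogonal to
    [e1]. *)
Let liebNW x w : x \in N -> w \in W -> lieb x w = 0.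
Proof.
move=> xN wW; rewrite (liebNN xN (W_N wW)).
by have [-> _ _ _] := W_orth (W_lieb x wW); rewrite scale0r.
Qed.

(** If [x, e1] were a nonzero multiple of [e1], then [e1] would lie in every term of the lower
    central series. *)
Let liebN1 x : x \in N -> lieb x e1 = 0.
Proof.
move=> xN; have xe := liebNN xN e1N.
have [a0|a0] := eqVneq (met (lieb x e1) e1) 0; first by rewrite xe a0 scale0r.
have [_ [_ [l Nl] _] _] := an_g.
have : e1 \in lcs N l.
  elim: l {Nl} => [|l IHl]; first exact: e1N.
  have -> : e1 = (met (lieb x e1) e1)^-1 *: lieb x e1.
    by rewrite {2}xe scalerA mulVf // scale1r.
  by rewrite memvZ // lieb_lieS.
by rewrite Nl memv0 => /eqP ->; rewrite lieb0r.
Qed.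

Let N2 : lcs N 2 = 0%VS.
Proof.
apply/eqP; rewrite -subv0; apply/lieS_subP => x y xN.
rewrite [lieS _ _]e1_N1 => /vlineP[k ->].
by rewrite liebZr liebN1 // scaler0 mem0v.
Qed.

(** By the previous lemma N^2 = 0, so strong unimodularity for l = 1 says that [et] acts with trace
    0 on the line N^1. *)
Let liebt1 : lieb et e1 = 0.
Proof.
have N1_ideal : is_ideal (lcs N 1) by apply: lieS_ideal.
have := su_g.2 et 1%N; rewrite N2.
rewrite (@quo_traceE _ _ et _ _ _ [:: e1] id (fun u x => met x u)).
- rewrite big_seq1.
  have : lieb et e1 \in lcs N 1.
    by move/is_idealP: N1_ideal; apply; rewrite e1_N1 memv_line.
  rewrite e1_N1 => /vlineP[k ->]; rewrite dotZl e1_unit mulr1 => ->.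
  by rewrite scale0r.
- exact: sub0v.
- by move=> y; move: et y; apply/is_idealP.
- by move=> y; rewrite memv0 => /eqP ->; rewrite lieb0r mem0v.
- by move=> u a x y; rewrite dotDl dotZl.
- by move=> u; rewrite inE => /eqP ->; rewrite e1_N1 memv_line.
- by move=> u _ y; rewrite memv0 => /eqP ->; rewrite dot0l.
move=> y; rewrite e1_N1 => /vlineP[k ->]; rewrite big_seq1 dotZl e1_unit mulr1.
by rewrite subrr mem0v.
Qed.

Let e1_central x : lieb e1 x = 0.
Proof.
have [y yN ->] := N_split_t x.
by rewrite liebDr liebZr ![lieb e1 _]liebC liebN1 // liebt1 !oppr0 scaler0 addr0.
Qed.

Let c := met (lieb e2 e3) e1.

Let lieb23 : lieb e2 e3 = c *: e1.
Proof. exact: liebNN. Qed.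

Let liebWN w x : w \in W -> x \in N -> lieb w x = 0.
Proof. by move=> wW xN; rewrite liebC liebNW ?oppr0. Qed.

Let lieb2N x : x \in N -> lieb e2 x = (met x e3 * c) *: e1.
Proof.
move=> xN; have [w wW {1}->] := N_split xN.
rewrite !liebDr !liebZr [lieb e2 e1]liebC e1_central liebxx lieb23 liebNW //.
by rewrite oppr0 !scaler0 !add0r addr0 scalerA.
Qed.

(** For c = 0 the nilradical would be abelian, against dim N^1 = 1. *)
Let c_neq0 : c != 0.
Proof.
apply/eqP => c0.
have l2 x : x \in N -> lieb e2 x = 0.
  by move=> xN; rewrite lieb2N // c0 mulr0 scale0r.
have N0 : lcs N 1 = 0%VS.
  apply/eqP; rewrite -subv0; apply/lieS_subP => x y xN yN; rewrite memv0.
  have [w wW ->] := N_split xN; have [w' w'W ->] := N_split yN.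
  have l32 : lieb e3 e2 = 0 by rewrite liebC l2 ?oppr0.
  rewrite !liebDl !liebZl e1_central !liebDr !liebZr !l2 //; try exact: W_N.
  rewrite [lieb e3 e1]liebC [lieb w e1]liebC !e1_central l32 liebxx.
  rewrite (liebNW e3N w'W) (liebWN wW (W_N w'W)) !(liebWN wW) //.
  by rewrite !oppr0 !(scaler0, addr0).
by move: dim_N1; rewrite N0 dimv0.
Qed.

(** Integrability at (et, e1), where [et, e1] = [e3, e1] = 0, reads c e1 = J [et, e2]. *)
Let liebt2 : lieb et e2 = - c *: e2.
Proof.
have := nijenhuis_eq herm et e1; rewrite e3E e2E liebt1 subr0 liebNl.
rewrite [lieb e3 e2]liebC opprK lieb23 liebNl [lieb e3 e1]liebC e1_central.
rewrite !oppr0 add0r => /(congr1 J); rewrite JJ linearZ /= e2E => ce2.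
by rewrite scaleNr ce2 opprK.
Qed.

(** Apply the derivation ad(et) to [e2, e3] = c e1, which it kills: the e3-coefficient of [et, e3]
    must cancel the factor - c of [et, e2]. *)
Let liebt3 : exists2 r, r \in N /\ met r e3 = 0 & lieb et e3 = c *: e3 + r.
Proof.
set y := lieb et e3; have yN : y \in N by apply: N_lieb.
have := lieb_derivation et e2 e3.
rewrite lieb23 liebZr liebt1 scaler0 liebt2 liebZl lieb23 -/y lieb2N //.
rewrite scalerA -scalerDl => /esym/eqP; rewrite scaler_eq0.
have -> : (e1 == 0) = false by rewrite -(dot_eq0 met) e1_unit oner_eq0.
rewrite orbF mulNr addrC -mulrBl mulf_eq0 (negPf c_neq0) orbF subr_eq0.
move/eqP => yc; exists (y - c *: e3); last by rewrite addrC subrK.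
by rewrite rpredB ?rpredZ // dotDl dotNl dotZl m33 yc mulr1 subrr.
Qed.

(** * The action of [et] on k3 *)

Let A := ad et.

Let AE x : A x = lieb et x. Proof. exact: adE. Qed.

Let W_A x : x \in W -> A x \in W.
Proof. by rewrite AE; apply: W_lieb. Qed.

Let AJ x : x \in W -> A (J x) = J (A x).
Proof.
move=> xW; have := nijenhuis_eq herm et x.
rewrite e3E !(liebNl, liebNW e3N) ?W_J // oppr0 sub0r add0r -!AE.
by move/(congr1 J); rewrite linearN JJ => /oppr_inj <-.
Qed.

Let J_N x : met x e3 = 0 -> J x \in N.
Proof. by move=> x3; rewrite etN dotJl e3E dotNr x3 !oppr0. Qed.

(** This is the SKT equation at (x, J x, e3, et). The remainder [r] of [et, e3] disappears because
    [r] and [J r] are in [N] and thus commute with [W]. *)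
Let skt_W x : x \in W ->
  met (A x) (A x) + met (A (A x)) x + c * met (A x) x = 0.
Proof.
move=> xW; have JxW := W_J xW; have AxW := W_A xW.
have [r [rN r3] lieb3] := liebt3.
have := skt_bismut herm x (J x) e3 et; rewrite /bismut.
have [_ sktJ _ _ _] := J_skt; move/(_ sktJ).
have lW u w : u \in W -> w \in W -> lieb u w = 0.
  by move=> uW wW; apply: liebNW => //; apply: W_N.
rewrite (lW x (J x)) // (liebWN xW e3N) (liebWN JxW e3N).
rewrite [lieb x et]liebC [lieb (J x) et]liebC [lieb e3 et]liebC -!AE (AJ xW).
rewrite [A e3]AE lieb3 Je3 JJ !(linear0, linearN, linearD, linearZ) /=.
have JAxW := W_J AxW; have JrN := J_N r3.
have lt u : lieb u et = - A u by rewrite AE liebC.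
rewrite JJ Je3 !(liebDl, liebNl, liebNr, liebZl, lieb0l) !lt -!AE.
rewrite (lW (J (A x)) x) // (lW (J x) x) // (lW (A x) (J x)) //.
rewrite (liebNW JrN JxW) (liebNW JrN xW) !AJ //.
rewrite !(opprK, linearN) /=.
rewrite !(dotDl, dotNl, dotNr, dotZl, dot0l, oppr0, dotJJ) (dotC met (A (A x))).
lra.
Qed.

Let W_skew : {in W &, forall x y, met (A x) y = - met x (A y)}.
Proof.
have [s sW sE] := exists_frame met W.
have so u : u \in s -> [/\ met e1 u = 0, met e2 u = 0, met e3 u = 0 & met et u = 0].
  by move=> /sW /W_orth[? ? ? ?]; rewrite !(dotC met _ u).
(* Unimodularity for l = 0 gives trace 0 on N/N^1, where the contributions - c of [e2] and c of [e3]
   cancel. *)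
have trA : \sum_(u <- s) met (A u) u = 0.
  have := su_g.2 et 0%N.
  rewrite (@quo_traceE _ _ et _ _ _ [:: e2, e3 & s] id (fun u x => met x u)).
  - rewrite !big_cons liebt2; have [r [_ r3] ->] := liebt3.
    rewrite !dotE m22 m33 r3 => h.
    under eq_bigr do rewrite AE.
    by move: h => /=; lra.
  - by apply/lieS_subP => u w _; apply: N_lieb.
  - by move=> y; apply: N_lieb.
  - by move=> y; move: et y; apply/is_idealP; apply: lieS_ideal.
  - by move=> u a x y; rewrite dotDl dotZl.
  - move=> u; rewrite !inE => /or3P[/eqP ->|/eqP ->|/sW/W_N] //.
  - move=> u uS y; rewrite e1_N1 => /vlineP[k ->]; rewrite dotZl.
    suff -> : met e1 u = 0 by rewrite mulr0.
    by move: uS; rewrite !inE => /or3P[/eqP ->|/eqP ->|/so[]].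
  move=> y yN; have [w wW yE] := N_split yN; rewrite e1_N1.
  apply/vlineP; exists (met y e1); rewrite !big_cons {1}yE.
  have -> : \sum_(u <- s) met y u *: u = w.
    rewrite [RHS](sE _ wW); apply: eq_big_seq => u /so[u1 u2 u3 _].
    by rewrite yE !dotDl !dotZl u1 u2 u3 !mulr0 !add0r.
  by rewrite addrA -[_ *: e1 + _ + _]addrA -[_ *: e1 + _ + w]addrA addrK.
apply: (skew_of_frame W_A sW sE).
have : \sum_(u <- s) (met (A u) (A u) + met (A (A u)) u + c * met (A u) u) = 0.
  by rewrite big1_seq // => u /andP[_ /sW]; apply: skt_W.
by rewrite big_split /= -mulr_sumr trA mulr0 addr0.
Qed.

(** The vector [e3] is corrected to an eigenvector of ad(et). On [W] this requires solving (c - A) w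
    = v, possible since [A] is skew there and c is nonzero. *)
Let shift_f3 : exists2 z, z \in N &
  [/\ lieb et (e3 + z) = c *: (e3 + z), lieb e2 z = 0 & met z e3 = 0].
Proof.
have [r [rN r3] lieb3] := liebt3.
have [v vW rE] := N_split rN; rewrite r3 scale0r addr0 in rE.
pose G := (c *: \1 - A)%VF.
have GE x : G x = c *: x - A x.
  by rewrite add_lfunE opp_lfunE scale_lfunE id_lfunE.
have GW : (G @: W)%VS = W.
  apply/eqP; rewrite eqEdim; apply/andP; split.
    apply/subvP => _ /memv_imgP[x xW ->].
    by rewrite GE rpredB ?rpredZ ?W_A.
  rewrite limg_dim_eq //; apply/eqP; rewrite -subv0; apply/subvP => x.
  rewrite memv_cap memv_ker GE subr_eq0 memv0 => /andP[xW /eqP Ax].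
  rewrite -(dot_eq0 met); have := W_skew xW xW.
  rewrite -Ax dotZl dotZr => h.
  have /eqP : c * met x x = 0 by lra.
  by rewrite mulf_eq0 (negPf c_neq0).
have : v \in (G @: W)%VS by rewrite GW.
move=> /memv_imgP[w wW]; rewrite GE => vE.
(* The condition is c z - [et, z] = r; as ad(et) is 0 on [e1] and - c on [e2], the divisors are c
   and 2c. *)
pose z := (met r e1 / c) *: e1 + (met r e2 / (c *+ 2)) *: e2 + w.
have zN : z \in N by rewrite !rpredD ?rpredZ // W_N.
have z3 : met z e3 = 0.
  by rewrite !dotDl !dotZl m13 m23; have [_ _ -> _] := W_orth wW; ring.
have z2 : lieb e2 z = 0 by rewrite lieb2N // z3 mul0r scale0r.
exists z => //; split=> //.
rewrite liebDr lieb3 scalerDr -addrA; congr (_ + _).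
rewrite rE vE /z !liebDr !liebZr liebt1 liebt2 AE scaler0 add0r !scalerDr !scalerA.
rewrite addrACA subrK; congr (_ + _); rewrite -addrA -scalerDl.
by congr (_ *: _ + _ *: _); field.
Qed.

Lemma special_skt_adapted_of_units : exists (f : (2 * n).-tuple g) (b : nat -> R),
  adapted_basis f b.
Proof.
pose A' := (c^-1 *: A)%VF.
have A'E x : A' x = c^-1 *: A x by rewrite scale_lfunE.
have [|x xW|x xW|x y xW yW|s [b [Ws sW size_s sA]]] :=
  @skew_normal_form _ _ met J A' W JJ dotJJ.
- exact: W_J.
- by rewrite A'E rpredZ // W_A.
- by rewrite !A'E AJ // linearZ.
- by rewrite !A'E dotZl dotZr W_skew // mulrN.
have [z zN [lieb3 lieb2z z3]] := shift_f3.
(* Dividing [et] by c normalises the eigenvalues on f_2 and f_3 to -1 and 1; f_1 = - c e1 makes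
   [f_2, f_3] = - f_1. *)
pose fs := [:: - c *: e1, e2, e3 + z & rcons s (c^-1 *: et)].
have size_f : size fs == (2 * n)%N.
  by rewrite /= size_rcons size_s dim_W; apply/eqP; lia.
pose f := Tuple size_f.
have size_s' : size s = (2 * n - 4)%N by rewrite size_s dim_W.
have v1E : vec f 1 = - c *: e1 by [].
have v2E : vec f 2 = e2 by [].
have v3E : vec f 3 = e3 + z by [].
have vtE : vec f (2 * n) = c^-1 *: et.
  rewrite /vec /=.
  have -> : (2 * n).-1 = (size s).+3 by rewrite size_s'; lia.
  by rewrite /= nth_rcons ltnn eqxx.
have vsE k : (k < size s)%N -> vec f k.+4 = s`_k.
  by move=> ks; rewrite /vec /= nth_rcons ks.
have veE l : (1 <= l <= n - 2)%N -> vec f (2 * l + 2) = s`_(2 * l.-1).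
  move=> lP; have -> : (2 * l + 2 = (2 * l.-1).+4)%N by lia.
  by rewrite vsE // size_s'; lia.
have voE l : (1 <= l <= n - 2)%N -> vec f (2 * l + 3) = s`_(2 * l.-1).+1.
  move=> lP; have -> : (2 * l + 3 = (2 * l.-1).+1.+4)%N by lia.
  by rewrite vsE // size_s'; lia.
have sl k : (k < size s)%N -> s`_k \in W by move=> ks; rewrite sW ?mem_nth.
have f_basis : basis_of fullv f.
  rewrite basisEdim (eqP size_f) dim_g leqnn andbT.
  have fspan u : u \in fs -> u \in <<f>>%VS by apply: memv_span.
  have sub1 : e1 \in <<f>>%VS.
    have -> : e1 = (- c)^-1 *: (- c *: e1).
      by rewrite scalerA mulVf ?oppr_eq0 // scale1r.
    by rewrite rpredZ // fspan // inE eqxx.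
  have sub2 : e2 \in <<f>>%VS by rewrite fspan // !inE eqxx orbT.
  have subt : et \in <<f>>%VS.
    have -> : et = c *: (c^-1 *: et) by rewrite scalerA mulfV // scale1r.
    by rewrite rpredZ // fspan // !inE mem_rcons inE eqxx !orbT.
  have subW w : w \in W -> w \in <<f>>%VS.
    move=> /(subvP Ws); apply/subvP/span_subvP => u us.
    by rewrite fspan // !inE mem_rcons inE us !orbT.
  have sub3 : e3 \in <<f>>%VS.
    have -> : e3 = (e3 + z) - z by rewrite addrK.
    apply: rpredB; first by rewrite fspan // !inE eqxx !orbT.
    have [w wW ->] := N_split zN.
    by rewrite z3 scale0r addr0 !rpredD ?rpredZ // subW.
  apply/subvP => x _; have [y yN ->] := N_split_t x; have [w wW ->] := N_split yN.
  by rewrite !rpredD ?rpredZ // subW.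
have tN y : cov f (2 * n) y = 0 -> y \in N.
  move=> ty; rewrite (cov_expand f_basis y) big_seq; apply: memv_suml => k.
  rewrite mem_index_iota ltnS; move: k.
  apply: (adapted_index_ind n_ge2) => [||||l lP].
  - by rewrite v1E !rpredZ.
  - by rewrite v2E rpredZ.
  - by rewrite v3E rpredZ // rpredD.
  - by rewrite ty scale0r mem0v.
  by rewrite veE // voE // !rpredZ // W_N // sl // size_s'; lia.
have lieb_f x : lieb (vec f (2 * n)) x = A' x by rewrite vtE liebZl A'E AE.
(* The normal form numbers its planes from 0, the adapted basis from 1. *)
exists f, (fun l => b l.-1); apply: (adapted_of_brackets f_basis n_ge2).
- by move=> y _; rewrite v1E liebZl e1_central scaler0.
- move=> l lP y /tN yN; rewrite veE // voE //.
  by split; apply: liebWN => //; apply: sl; rewrite size_s'; lia.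
- by rewrite v2E v3E v1E liebDr lieb23 lieb2z addr0 scaleNr opprK.
- by rewrite lieb_f A'E AE v1E liebZr liebt1 !scaler0.
- by rewrite lieb_f A'E AE v2E liebt2 scalerA mulrN mulVf // scaleN1r.
- by rewrite lieb_f A'E AE v3E lieb3 scalerA mulVf // scale1r.
move=> l lP; rewrite !lieb_f veE // voE //; apply: sA.
by rewrite size_s'; lia.
Qed.

End SpecialSKT.

Lemma special_skt_adapted (R : realType) (n : nat) (g : lieAlgType R)
    (N : {vspace g}) (J : 'End(g)) (met : {dot g for idfun}) :
    (2 <= n)%N -> \dim {:g} = (2 * n)%N -> almost_nilpotent N ->
    strongly_unimodular N -> \dim (lcs N 1) = 1%N -> special_skt J met N ->
  exists (f : (2 * n).-tuple g) (b : nat -> R), adapted_basis f b.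
Proof.
move=> n_ge2 dim_g an_g su_g dim_N1 J_skt.
have [e1 e1N e1_unit] : exists2 e, e \in lcs N 1 & met e e = 1.
  by apply: exists_unit; rewrite -dimv_eq0 dim_N1.
have [_ _ dimN] := an_g; have [et et_unit etN] := unit_normal met dimN.
have e1_N1 : lcs N 1 = <[e1]>%VS.
  apply/esym/eqP; rewrite eqEdim -memvE e1N dim_N1 dim_vline.
  by rewrite -(dot_eq0 met) e1_unit oner_eq0.
(* The last two arguments fix [e2] as [J e1] and [e3] as [- J et]. *)
exact: (special_skt_adapted_of_units n_ge2 dim_g an_g su_g dim_N1 J_skt e1_unit
  e1_N1 et_unit etN erefl (esym (opprK _))).
Qed.

Theorem theorem4p17 (R : realType) (n : nat) (g : lieAlgType R)
    (N : {vspace g})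
    (n_ge2 : (2 <= n)%N)
    (dim_g : \dim {:g} = (2 * n)%N)
    (an_g : almost_nilpotent N)
    (su_g : strongly_unimodular N)
    (dim_N1 : \dim (lcs N 1) = 1%N) :
  ((exists (J : 'End(g)) (met : {dot g for idfun}), special_skt J met N) <->
   (exists (f : (2 * n).-tuple g) (b : nat -> R), adapted_basis f b)) /\
  (forall (f : (2 * n).-tuple g) (b : nat -> R), adapted_basis f b ->
    [/\ step_solvable g 3,
        decomposable g <-> (exists2 l, (1 <= l <= n - 2)%N & b l = 0),
        ~ (exists (J : 'End(g)) (met : {dot g for idfun}),
             hermitian_structure J met /\ kaehler J met)
      & exists (J : 'End(g)) (met : {dot g for idfun}),
          [/\ standard_J f J, standard_metric f met & special_skt J met N]]).
Proof.
split.
  split=> [[J [met]]|[f [b fP]]]; first exact: special_skt_adapted.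
  have [J JE] := standard_J_exists n_ge2 fP.
  have [f_basis _ _] := fP; have [met metE] := standard_metric_exists f_basis.
  by exists J, met; apply: (standard_special_skt n_ge2 fP JE metE).
move=> f b fP; split.
- exact: (adapted_step_solvable n_ge2 fP).
- split; first exact: (adapted_decomposable n_ge2 fP).
  by case=> l lP bl; apply: (adapted_decomposable_zero n_ge2 fP lP bl).
- by case=> J [met [herm kae]]; apply: (adapted_not_kaehler n_ge2 fP herm kae).
have [J JE] := standard_J_exists n_ge2 fP.
have [f_basis _ _] := fP; have [met metE] := standard_metric_exists f_basis.
exists J, met; split=> //.
  exact: (standard_J_vec n_ge2 fP JE).
exact: (standard_special_skt n_ge2 fP JE metE).
Qed.
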